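(* For locally compact paracompact spaces $X$ and $Y$ the following conditions are equivalent. (1) $\mathcal T_{CL}(X)$ and $\mathcal T_{CL}(Y)$ are order-isomorphic; (2) $\sigma X\setminus X$ and $\sigma Y\setminus Y$ are homeomorphic.
   Context: Compact, locally compact and paracompact spaces are assumed Hausdorff. For a Tychonoff space $X$, a one-point extension of $X$ is a Tychonoff space $T$ containing $X$ as a dense subspace such that $T\setminus X$ is a singleton. Two extensions are identified if there is a homeomorphism between them fixing $X$ pointwise. For extensions $T_1,T_2$ of $X$, $T_2\leq T_1$ means there is a continuous $f:T_1\to T_2$ fixing $X$ pointwise; this is a partial order on the set $\mathcal T(X)$ of all (equivalence classes of) one-point extensions of $X$. $\mathcal T_{CL}(X)$ is the set (with the induced order) of all $T\in\mathcal T(X)$ that are both Čech-complete and Lindelöf. $\beta X$ is the Stone-Čech compactification of $X$ and $\sigma X=\bigcup\{\mathrm{cl}_{\beta X}A: A\subseteq X\text{ is }\sigma\text{-compact}\}$. Partially ordered sets are order-isomorphic if there is a bijection between them that is order-preserving with order-preserving inverse. *)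

(* Defs.v *)
From HB Require Import structures.
From mathcomp Require Import all_boot all_order all_algebra.
From mathcomp Require Import all_classical all_reals all_analysis.
From mathcomp Require Import borel_hierarchy.
Import Order.TTheory GRing.Theory Num.Theory.
Import numFieldNormedType.Exports.

Set Implicit Arguments.
Unset Strict Implicit.
Unset Printing Implicit Defensive.

Local Open Scope classical_set_scope.
Local Open Scope ring_scope.

Definition tychonoff_space (X : topologicalType) :=
  hausdorff_space X /\ completely_regular_space X.

Definition locally_compact_space (X : topologicalType) :=
  hausdorff_space X /\ locally_compact [set: X].

Definition locally_finite_family (X : topologicalType) (V : set (set X)) :=
  forall x : X, exists2 N, nbhs x N & finite_set [set v | V v /\ v `&` N !=set0].

Definition paracompact_space (X : topologicalType) :=
  hausdorff_space X /\
  forall U : set (set X), U `<=` open -> \bigcup_(u in U) u = setT ->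
  exists V : set (set X),
    [/\ V `<=` open, \bigcup_(v in V) v = setT,
        (forall v, V v -> exists2 u, U u & v `<=` u)
      & locally_finite_family V].

Definition lindelof_space (X : topologicalType) :=
  forall U : set (set X), U `<=` open -> \bigcup_(u in U) u = setT ->
  exists V : set (set X),
    [/\ V `<=` U, countable V & \bigcup_(v in V) v = setT].

Definition sigma_compact (X : topologicalType) (A : set X) :=
  exists2 F : nat -> set X, (forall n, compact (F n)) & A = \bigcup_n F n.

Definition topological_embedding (X Y : topologicalType) (i : X -> Y) :=
  injective i /\ @open X = @open (initial_topology i).

Definition homeomorphic (X Y : topologicalType) :=
  exists (f : X -> Y) (g : Y -> X),
    [/\ continuous f, continuous g, cancel f g & cancel g f].

(* The Stone-Cech compactification of X: the closure of the image of X in the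
   product of copies of the line indexed by the continuous maps X -> [0, 1].
   The image lies in the cube [0, 1]^I, which is closed in the product, so this
   is the closure in the cube. *)
Section stone_cech.
Variables (R : realType) (X : topologicalType).

Definition unit_map : set (X -> R) :=
  [set f : X -> R | continuous f /\ forall x, 0 <= f x <= 1].

Definition cube : topologicalType := prod_topology (fun _ : unit_map => R).

Definition eval_cube : X -> cube := fun x f => set_val f x.

Definition stone_cech : topologicalType := set_type (closure (range eval_cube)).

Lemma eval_cube_closure x : eval_cube x \in closure (range eval_cube).
Proof. by apply/mem_set; apply: subset_closure; exists x. Qed.

Definition to_stone_cech (x : X) : stone_cech :=
  exist _ (eval_cube x) (eval_cube_closure x).

Lemma eval_cube_continuous : continuous eval_cube.
Proof.
move=> x; apply/cvg_sup => f U /= [_ [[W oW <-]] Wx] /filterS; apply.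
have [cf _] : unit_map (set_val f) by exact: set_valP.
by apply: cf; exact: open_nbhs_nbhs.
Qed.

Lemma to_stone_cech_continuous : continuous to_stone_cech.
Proof.
apply/continuousP => _ [V oV <-].
by move/continuousP: eval_cube_continuous => /(_ V oV).
Qed.

Lemma stone_cech_val_continuous : continuous (set_val : stone_cech -> cube).
Proof. exact: initial_continuous. Qed.

Lemma cube_hausdorff : hausdorff_space cube.
Proof. by apply: hausdorff_product => ?; exact: Rhausdorff. Qed.

Lemma stone_cech_hausdorff : hausdorff_space stone_cech.
Proof.
move=> p q pq; apply: val_inj; apply: cube_hausdorff.
move=> A B /stone_cech_val_continuous pA /stone_cech_val_continuous qB.
by have [z []] := pq _ _ pA qB; exists (set_val z).
Qed.

Lemma stone_cech_compact : compact [set: stone_cech].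
Proof.
have ccl : compact (closure (range eval_cube)).
  pose K := [set g : cube | forall f, `[0, 1]%classic (g f)].
  have cK : compact K := @tychonoff unit_map (fun=> R) (fun=> `[0, 1]%classic)
    (fun=> @segment_compact R 0 1).
  apply: (subclosed_compact _ cK); first exact: closed_closure.
  have clK : closed K by apply: compact_closed => //; exact: cube_hausdorff.
  rewrite ((closure_id K).1 clK); apply: closureS => _ [x _ <-] f /=.
  have [_ f01] : unit_map (set_val f) by exact: set_valP.
  by rewrite in_itv /=; exact: f01.
move=> F PF _.
have [|y [cly Fy]] := ccl (set_val @ F) _.
  apply: (@filterS _ F _ setT); last exact: filterT.
  by move=> z _; exact: set_valP.
exists (exist _ y (mem_set cly)); split=> // A B FA [_ [[V oV <-] Vy]] /= VB.
have [] := Fy (set_val @` A) V.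
- by apply: (@filterS _ F _ A) => // z Az; exists z.
- exact: open_nbhs_nbhs.
by move=> _ [[z Az <-] Vz]; exists z; split=> //; exact: VB.
Qed.

Lemma to_stone_cech_embedding :
  tychonoff_space X -> topological_embedding to_stone_cech.
Proof.
move=> [hX crX].
have sepX (x : X) (B : set X) : closed B -> ~ B x ->
    exists f : unit_map, set_val f x = 0 /\ forall y, B y -> set_val f y = 1.
  move=> clB nBx.
  have /(@uniform_separatorP _ R)[f [cf f01 fx fB]] := crX x B clB nBx.
  have uf : unit_map f.
    by split=> // y; have /= := f01 (f y) (imageT f y); rewrite in_itv.
  exists (exist _ f (mem_set uf)); split; first by apply: fx; exists x.
  by move=> y By; apply: fB; exists y.
split.
  move=> x y xy; apply: contrapT => xNy.
  have [f [fx fy]] := sepX x [set y]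
    (@accessible_closed_set1 _ (hausdorff_accessible hX) y) xNy.
  have := congr1 (fun z => set_val z f) xy => /= exy.
  have : set_val f x = set_val f y by exact: exy.
  by rewrite fx fy// => /eqP; rewrite eq_sym oner_eq0.
apply/seteqP; split=> [U oU|_ [V oV <-]]; last first.
  by move/continuousP: to_stone_cech_continuous; exact.
pose W := \bigcup_(f : unit_map)
  \bigcup_(_ in [set _ : unit | forall y, (~` U) y -> set_val f y = 1])
    [set z : stone_cech | set_val z f < 1].
exists W.
  apply: bigcup_open => f _; apply: bigcup_open => _ _.
  exists (@proj _ (fun=> R) f @^-1` [set r | r < 1]) => //.
  apply: open_comp; last exact: open_lt.
  by move=> z _; exact: proj_continuous.
apply/seteqP; split=> x /=.
  move=> [f _ [[] fU fx1]]; apply: contrapT => nUx.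
  have : set_val f x < 1 by exact: fx1.
  by rewrite (fU x nUx) ltxx.
move=> Ux; have [|f [fx fU]] := sepX x _ (open_closedC oU).
  by move=> /(_ Ux).
exists f => //; exists tt => //=.
by have -> : set_val (to_stone_cech x) f = 0 by exact: fx.
Qed.

Lemma to_stone_cech_dense : dense (range to_stone_cech).
Proof.
move=> _ [z /[swap] [[V oV <-]]] Vz.
have [|_ [[x _ <-] Vx]] := set_valP z V; first exact: open_nbhs_nbhs.
by exists (to_stone_cech x); split=> //; exists x.
Qed.

Lemma stone_cech_extension (f : X -> R) :
    continuous f -> (forall x, 0 <= f x <= 1) ->
  exists2 g : stone_cech -> R, continuous g & g \o to_stone_cech = f.
Proof.
move=> cf f01; pose i : unit_map := exist _ f (mem_set (conj cf f01)).
pose pi : cube -> R := @proj _ (fun=> R) i.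
have pi_cont : continuous pi by exact: (@proj_continuous _ (fun=> R)).
exists (pi \o (set_val : stone_cech -> cube)) => // z.
by apply: continuous_comp; [exact: stone_cech_val_continuous|exact: pi_cont].
Qed.

Definition cech_complete := tychonoff_space X /\ Gdelta (range to_stone_cech).

Definition sigma_extension : set stone_cech :=
  \bigcup_(A in @sigma_compact X) closure (to_stone_cech @` A).

Definition sigma_remainder : topologicalType :=
  set_type (sigma_extension `\` range to_stone_cech).

End stone_cech.

Arguments cech_complete R X : clear implicits.
Arguments sigma_remainder R X : clear implicits.

Record one_point_extension (X : topologicalType) := OnePointExtension {
  ext_space :> topologicalType;
  ext_map : X -> ext_space;
  ext_tychonoff : tychonoff_space ext_space;
  ext_embedding : topological_embedding ext_map;
  ext_dense : dense (range ext_map);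
  ext_singleton : exists p, ~` range ext_map = [set p] }.

Section extension_order.
Variable X : topologicalType.
Implicit Types T : one_point_extension X.

Definition ext_le T2 T1 :=
  exists2 f : T1 -> T2, continuous f & forall x, f (ext_map T1 x) = ext_map T2 x.

Definition ext_equiv T1 T2 :=
  exists (f : T1 -> T2) (g : T2 -> T1),
    [/\ continuous f, continuous g, cancel f g, cancel g f &
        forall x, f (ext_map T1 x) = ext_map T2 x].

(* The elements of T(X). Extensions range over all topological spaces and so live
   above the universe of [set]; a class is therefore a bare Prop-valued predicate. *)
Definition ext_class := {C : one_point_extension X -> Prop |
  exists T, C = ext_equiv T}.

Definition ext_class_le (C2 C1 : ext_class) :=
  exists T1 T2, [/\ sval C1 T1, sval C2 T2 & ext_le T2 T1].

End extension_order.

Definition ext_class_CL (R : realType) (X : topologicalType) :=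
  {C : ext_class X | exists T, [/\ sval C T, cech_complete R T & lindelof_space T]}.

Definition ext_class_CL_le (R : realType) (X : topologicalType)
  (C2 C1 : ext_class_CL R X) := ext_class_le (sval C2) (sval C1).

Definition order_isomorphic (A B : Type)
    (leA : A -> A -> Prop) (leB : B -> B -> Prop) :=
  exists (f : A -> B) (g : B -> A),
    [/\ cancel f g, cancel g f,
        (forall x y, leA x y -> leB (f x) (f y)) &
        (forall x y, leB x y -> leA (g x) (g y))].

(* Main.v *)
Require Import Defs.
From mathcomp Require Import all_boot all_order all_algebra.
From mathcomp Require Import all_classical all_reals all_analysis.
From mathcomp Require Import borel_hierarchy.
From HB Require Import structures.
Import Order.TTheory GRing.Theory Num.Theory.
Import numFieldNormedType.Exports.

Set Implicit Arguments.
Unset Strict Implicit.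
Unset Printing Implicit Defensive.

Local Open Scope classical_set_scope.
Local Open Scope ring_scope.

(** Write b for the embedding of X into its Stone-Cech compactification bX,
    sX for the union of the closures in bX of the sigma-compact subsets of X,
    and S for the remainder sX \ X.

    A one-point extension T of X, with added point p, is encoded by an open
    subset of bX: the set [away T] of the points that have a neighbourhood whose
    trace on X does not accumulate at p.  A subset of X does not accumulate at
    p if and only if its closure in bX lies in [away T]
    ([notin_closure_awayP]).  This gives a dictionary:
    - T2 <= T1 iff [away T2] is included in [away T1] ([ext_leP]);
    - T is Lindelof iff [away T] is included in sX ([lindelof_away],
      [away_lindelof]);
    - T is Cech-complete iff [away T] \ X is sigma-compact
      ([cech_complete_away]), because [away T] is the complement of the fibre
      of p under the canonical map from bX to bT;
    - every open set E with X <= E < bX arises, from the extension in which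
      the complement of E is collapsed to one point ([away_attach]).
    So the poset of Cech-complete Lindelof one-point extensions is isomorphic
    to the poset P(S) of the open sigma-compact subsets of S other than S
    ([ext_class_CL_isomorphic]); D = S is what corresponds to the forbidden
    value E = bX, since S can only be sigma-compact when sX = bX
    ([sigma_compact_remainder]).  A homeomorphism of remainders therefore
    yields an isomorphism of the posets.

    Conversely P(S) determines S.  Paracompactness of X enters through one
    fact: every sigma-compact subset of X lies in a clopen sigma-compact
    subset ([clopen_sigma_compact_hull]).  Taking closures in bX, every
    sigma-compact subset of S lies in a compact open subset of S.  In such a
    space the maximal proper ideals of P(S) are the sets
    {D | x notin D} for x in S ([point_idealP]), so the points of S and the
    base of open sigma-compact sets are recovered from the order
    ([homeomorphic_of_order_isomorphic]). *)

(** * Compact and sigma-compact sets, embeddings *)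

(** A compact set covered by a directed family of open sets lies in one of them:
    otherwise the differences K \ a generate a filter with no cluster point in K. *)
Lemma compact_directed_cover (T : topologicalType) (K : set T)
    (G : set (set T)) :
  compact K -> G !=set0 ->
  (forall a b, G a -> G b -> exists2 c, G c & a `|` b `<=` c) ->
  (forall a, G a -> open a) -> K `<=` \bigcup_(a in G) a ->
  exists2 a, G a & K `<=` a.
Proof.
move=> cK [g0 Gg0] Gdir Gop KG; apply: contrapT => nK.
pose F := filter_from G (fun a => K `\` a).
have FF : ProperFilter F.
  apply: filter_from_proper; last first.
    move=> a Ga; apply: contrapT => /nonemptyPn Ka0.
    by apply: nK; exists a => //; rewrite -setD_eq0.
  apply: filter_from_filter; first by exists g0.
  move=> a b Ga Gb; have [c Gc abc] := Gdir _ _ Ga Gb; exists c => //.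
  by move=> x [Kx ncx]; split; split=> // ?; apply: ncx; apply: abc; [left|right].
have [|x [Kx Fx]] := cK F FF; first by exists g0 => // x [].
have [a Ga ax] := KG _ Kx.
have [||y [[_ nay] ay]] := Fx (K `\` a) a; first by exists a.
  by apply: open_nbhs_nbhs; split => //; exact: Gop.
exact: nay.
Qed.

Section sigma_compact_theory.
Variable T : topologicalType.
Implicit Types A B : set T.

Lemma compact_sigma_compact A : compact A -> sigma_compact A.
Proof.
move=> cA; exists (fun=> A) => //.
by apply/seteqP; split=> x => [Ax|[]//]; exists 0%N.
Qed.

Lemma sigma_compact_bigcup (I : Type) (D : set I) (F : I -> set T) :
  countable D -> (forall i, D i -> sigma_compact (F i)) ->
  sigma_compact (\bigcup_(i in D) F i).
Proof.
move=> /countable_injP[f finj] scF.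
have /choice[K KP] (i : I) : exists K : nat -> set T,
    D i -> (forall n, compact (K n)) /\ F i = \bigcup_n K n.
  have [/scF[K cK FK]|nDi] := pselect (D i); first by exists K.
  by exists (fun=> set0).
(* f is injective on D, so each H p is empty or a single compact set. *)
pose H (p : nat * nat) := \bigcup_(i in [set i | D i /\ f i = p.1]) K i p.2.
exists (fun n => if unpickle n is Some p then H p else set0).
  move=> n; case: (unpickle n) => [[a b]|]; last exact: compact0.
  have [[i [Di fi]]|noi] := pselect (exists i, D i /\ f i = a); last first.
    rewrite (_ : H _ = set0); first exact: compact0.
    by apply/seteqP; split=> // x [i ? _]; apply: noi; exists i.
  have -> : H (a, b) = K i b.
    apply/seteqP; split=> x => [[j [Dj fj]]|Kx]; last by exists i.
    by rewrite (finj j i) ?inE // fi fj.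
  by have [+ _] := KP i Di; apply.
apply/seteqP; split=> x => [[i Di Fx]|[n _]].
  move: (Fx); have [_ ->] := KP i Di => -[n _ Kx].
  by exists (pickle (f i, n)) => //; rewrite pickleK; exists i.
case: (unpickle n) => [[a b]|//] [i [Di _] Kx]; exists i => //.
by have [_ ->] := KP i Di; exists b.
Qed.

Lemma sigma_compactU A B :
  sigma_compact A -> sigma_compact B -> sigma_compact (A `|` B).
Proof.
move=> scA scB; rewrite -bigcup2E; apply: sigma_compact_bigcup => //.
by move=> [|[|n]] _ //=; apply: compact_sigma_compact; exact: compact0.
Qed.

End sigma_compact_theory.

Lemma sigma_compact_image (T U : topologicalType) (f : T -> U) (A : set T) :
  continuous f -> sigma_compact A -> sigma_compact (f @` A).
Proof.
move=> cf [K cK ->]; exists (fun n => f @` K n); last by rewrite image_bigcup.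
by move=> n; apply: continuous_compact => //; exact: continuous_subspaceT.
Qed.

Section embeddings.
Variables (X T : topologicalType) (i : X -> T).
Hypothesis emb : topological_embedding i.

Lemma embedding_openE (U : set X) :
  open U <-> exists2 V, open V & i @^-1` V = U.
Proof. by case: emb => _ ->. Qed.

Lemma embedding_continuous : continuous i.
Proof. by apply/continuousP => V oV; apply/embedding_openE; exists V. Qed.

Lemma embedding_compact (K : set X) : compact (i @` K) -> compact K.
Proof.
move=> cK F PF FK.
have [|_ [[z Kz <-] Fz]] := cK (i @ F) _.
  by apply: (@filterS _ F _ K) => // z Kz; exists z.
exists z; split=> // B C FB; rewrite nbhsE => -[U [/embedding_openE[V oV <-] Vz] UC].
have [] := Fz (i @` B) V.
- by apply: (@filterS _ F _ B) => // y By; exists y.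
- exact: open_nbhs_nbhs.
by move=> _ [[y By <-] Vy]; exists y; split=> //; exact: UC.
Qed.

Lemma embedding_closure_preimage (A : set X) :
  closed A -> i @^-1` closure (i @` A) = A.
Proof.
move=> clA; apply/seteqP; split=> [x|x Ax]; last first.
  by apply: subset_closure; exists x.
move=> clx; apply: contrapT => nAx.
have /embedding_openE[V oV VA] := closed_openC clA.
have [|_ [[y Ay <-] Vy]] := clx V.
  by apply: open_nbhs_nbhs; split=> //; change ((i @^-1` V) x); rewrite VA.
have : (i @^-1` V) y by [].
by rewrite VA; apply.
Qed.

Hypothesis dns : dense (range i).

Lemma dense_closure_preimage (z : T) (W : set T) :
  nbhs z W -> closure (i @` (i @^-1` W)) z.
Proof.
move=> zW N zN; have : nbhs z (W `&` N) by exact: filterI.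
rewrite nbhsE => -[G [oG Gz] GWN].
have [|_ [/[swap] [[x _ <-]]] Gx] := dns _ oG; first by exists z.
by have [Wx Nx] := GWN _ Gx; exists (i x); split=> //; exists x.
Qed.

(** A locally compact space is open in any Hausdorff space in which it is dense:
    an open set V whose trace lies in a compact set K lies in the closure of the
    image of K, which is that image. *)
Lemma dense_embedding_open (U : set X) :
  locally_compact_space X -> hausdorff_space T -> open U -> open (i @` U).
Proof.
move=> lcX hT oU; rewrite openE => _ [x Ux <-].
have [hX lX] := lcX; have [K xK [cK clK]] := lX x I.
have {}xK : nbhs x K by move: xK; rewrite withinET.
have : open (U `&` K°) by apply: openI => //; exact: open_interior.
move=> /embedding_openE[V oV VUK].
have Vx : V (i x).
  by change ((i @^-1` V) x); rewrite VUK; split.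
have clK' : closed (i @` K).
  apply: compact_closed => //; apply: continuous_compact => //.
  exact/continuous_subspaceT/embedding_continuous.
apply: (@filterS _ _ _ V); last exact: open_nbhs_nbhs.
move=> z Vz.
have [y Ky yz] : (i @` K) z.
  apply: clK' => N zN.
  have [|_ [[y Vy <-] Ny]] := @dense_closure_preimage z V _ N zN.
    exact: open_nbhs_nbhs.
  exists (i y); split=> //; exists y => //.
  have : (i @^-1` V) y by [].
  by rewrite VUK => -[_ /interior_subset].
exists y => //; have : (i @^-1` V) y by rewrite /= yz.
by rewrite VUK => -[].
Qed.

End embeddings.

Lemma set_val_embedding (T : topologicalType) (A : set T) :
  topological_embedding (set_val : A -> T).
Proof. by split=> //; exact: val_inj. Qed.

Lemma hausdorff_set_type (T : topologicalType) (A : set T) :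
  hausdorff_space T -> hausdorff_space (set_type A).
Proof.
move=> hT p q pq; apply: val_inj; apply: hT.
have cv : continuous (set_val : A -> T).
  exact: embedding_continuous (set_val_embedding A).
by move=> B C /cv pB /cv qC; have [z []] := pq _ _ pB qC; exists (set_val z).
Qed.

Lemma locally_compact_tychonoff (R : realType) (T : topologicalType) :
  locally_compact_space T -> tychonoff_space T.
Proof.
move=> [hT lT]; split=> //.
exact: (@locally_compact_completely_regular T R).
Qed.

(** If f separates x from the complement of a relatively compact neighbourhood
    inside U, with f x = 0, then {f < 1} is the union of the compact sets
    {f <= 1 - 1/(n+1)}. *)
Lemma open_sigma_compact_base (R : realType) (T : topologicalType) (x : T)
    (U : set T) :
  locally_compact_space T -> open U -> U x ->
  exists D, [/\ open D, sigma_compact D, D x & D `<=` U].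
Proof.
move=> lcT oU Ux; have [hT lT] := lcT.
have [_ crT] := locally_compact_tychonoff R lcT.
have [K xK [cK clK]] := lT x I.
have {}xK : nbhs x K.
  by move: xK; rewrite withinET.
have [f [cf f01 fx fU]] : exists f : T -> R, [/\ continuous f,
   (range f `<=` `[0%R, 1%R]), f @` [set x] `<=` [set 0] &
    f @` (~` (U `&` K°)) `<=` [set 1] ].
  apply/uniform_separatorP; apply: crT; last by apply; split.
  by apply: open_closedC; apply: openI => //; exact: open_interior.
have fx0 : f x = 0 by apply: fx; exists x.
have f1 y : f y < 1 -> U y /\ K y.
  move=> fy1; apply: contrapT => nUK.
  have : f y = 1.
    by apply: fU; exists y => // -[Uy /interior_subset Ky]; exact: nUK.
  by move=> fy; rewrite fy ltxx in fy1.
exists (f @^-1` [set r | r < 1]); split.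
- by move/continuousP : cf; apply; exact: open_lt.
- exists (fun n => f @^-1` [set r | r <= 1 - n.+1%:R^-1]).
    move=> n; apply: (subclosed_compact _ cK).
      by move/continuous_closedP : cf; apply; exact: closed_le.
    by move=> y /= fy; apply: (f1 y _).2; rewrite (le_lt_trans fy)// ltrBlDr ltrDl invr_gt0.
  apply/seteqP; split=> y /= => [fy1|[n _ fy]].
    have [n nP] : exists n, n.+1%:R^-1 < 1 - f y.
      have /ltr_add_invr[k] := fy1.
      by move=> Hk; exists k; rewrite ltrBrDl.
    by exists n => //=; rewrite lerBrDl -lerBrDr ltW.
  by rewrite (le_lt_trans fy)// ltrBlDr ltrDl invr_gt0.
- by rewrite /= fx0.
- by move=> y /= /f1 [].
Qed.

(** * Recovering a space from its open sigma-compact proper subsets *)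

Lemma sval_inj (T : Type) (Q : T -> Prop) (a b : {x | Q x}) :
  sval a = sval b -> a = b.
Proof. by case: a b => [a Qa] [b Qb] /= ab; exact: eq_exist. Qed.

Section points_of_a_poset.
Variables (P : Type) (le : P -> P -> Prop).

(** In the poset P(S), the last clause keeps the ideals that are contained in
    {D | x notin D} for some point x.  The whole poset has this form exactly when
    S = {x}, and then it has one element; if S is not compact, the whole poset is
    an ideal with several elements and lies in no set of this form. *)
Definition proper_ideal (I : set P) :=
  [/\ I !=set0, (forall a b, le a b -> I b -> I a),
      (forall a b, I a -> I b -> exists c, [/\ I c, le a c & le b c])
    & (I <> setT \/ forall a b : P, a = b)].

(** The order-theoretic notion of a point: see [point_idealP]. *)
Definition point_ideal (I : set P) :=
  proper_ideal I /\ forall J, proper_ideal J -> I `<=` J -> J = I.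

End points_of_a_poset.

Section order_isomorphisms.

Lemma order_isomorphic_sym (A B : Type) (leA : A -> A -> Prop)
    (leB : B -> B -> Prop) :
  order_isomorphic leA leB -> order_isomorphic leB leA.
Proof. by move=> [f [g [fK gK fle gle]]]; exists g, f. Qed.

Lemma order_isomorphic_trans (A B C : Type) (leA : A -> A -> Prop)
    (leB : B -> B -> Prop) (leC : C -> C -> Prop) :
  order_isomorphic leA leB -> order_isomorphic leB leC ->
  order_isomorphic leA leC.
Proof.
move=> [f [g [fK gK fle gle]]] [h [k [hK kK hle kle]]].
exists (h \o f), (g \o k); split.
- by move=> x /=; rewrite hK fK.
- by move=> x /=; rewrite gK kK.
- by move=> x y /fle/hle.
- by move=> x y /kle/gle.
Qed.

Lemma proper_ideal_preimage (A B : Type) (leA : A -> A -> Prop)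
    (leB : B -> B -> Prop) (f : A -> B) (g : B -> A) (I : set A) :
  cancel f g -> cancel g f ->
  (forall x y, leA x y -> leB (f x) (f y)) ->
  (forall x y, leB x y -> leA (g x) (g y)) ->
  proper_ideal leA I -> proper_ideal leB (g @^-1` I).
Proof.
move=> fK gK fle gle [[a Ia] Ilow Idir Iprop]; split.
- by exists (f a); rewrite /= fK.
- by move=> b c /gle; exact: Ilow.
- move=> b c Ib Ic; have [d [Id bd cd]] := Idir _ _ Ib Ic.
  by exists (f d); split; rewrite /= ?fK// -[X in leB X](gK); exact: fle.
- have [IT|Asub] := Iprop; [left|right].
    move=> gIT; apply: IT; apply/seteqP; split=> // x _.
    have : (g @^-1` I) (f x) by rewrite gIT.
    by move=> /=; rewrite fK.
  by move=> b c; rewrite -(gK b) -(gK c) (Asub (g b) (g c)).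
Qed.

Lemma point_ideal_preimage (A B : Type) (leA : A -> A -> Prop)
    (leB : B -> B -> Prop) (f : A -> B) (g : B -> A) (I : set A) :
  cancel f g -> cancel g f ->
  (forall x y, leA x y -> leB (f x) (f y)) ->
  (forall x y, leB x y -> leA (g x) (g y)) ->
  point_ideal leA I -> point_ideal leB (g @^-1` I).
Proof.
move=> fK gK fle gle [Iprop Imax]; split.
  exact: (proper_ideal_preimage fK gK fle gle).
move=> J /(proper_ideal_preimage gK fK gle fle)/Imax JI gIJ.
rewrite -JI; last by move=> a Ia; apply: gIJ; rewrite /= fK.
by apply/seteqP; split=> b /=; rewrite gK.
Qed.

End order_isomorphisms.

Section cozero_poset.
Variable S : topologicalType.

Definition open_sigma_compact_proper :=
  {D : set S | [/\ open D, sigma_compact D & D <> setT]}.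

Definition OpenSigmaCompactProper (D : set S) (oD : open D) (sD : sigma_compact D)
    (nD : D <> setT) : open_sigma_compact_proper :=
  exist _ D (And3 oD sD nD).

Definition subset_le (D1 D2 : open_sigma_compact_proper) := sval D1 `<=` sval D2.

End cozero_poset.

(** The property of the remainder S that makes its poset determine it.  It implies
    local compactness. *)
Definition sigma_compact_bounded (S : topologicalType) :=
  forall A : set S, sigma_compact A ->
  exists K, [/\ compact K, open K & A `<=` K].

Section recovery.
Variables (R : realType) (S : topologicalType).
Hypotheses (hS : hausdorff_space S) (bS : sigma_compact_bounded S).
Local Notation P := (open_sigma_compact_proper S).
Implicit Types D : P.

Lemma sigma_compact_bounded_locally_compact : locally_compact_space S.
Proof.
split=> // x _.
have [K [cK oK xK]] := bS (compact_sigma_compact (@compact_set1 _ x)).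
exists K; first by rewrite withinET; apply: open_nbhs_nbhs; split=> //; exact: xK.
by split=> //; exact: compact_closed.
Qed.

Lemma proper_base (x : S) (U : set S) : open U -> U x -> U <> setT ->
  exists2 D : P, sval D x & sval D `<=` U.
Proof.
move=> oU Ux UT.
have [D [oD scD Dx DU]] :=
  open_sigma_compact_base R sigma_compact_bounded_locally_compact oU Ux.
have DT : D <> setT.
  by move=> DT; apply: UT; apply/seteqP; split=> // y _; apply: DU; rewrite DT.
by exists (OpenSigmaCompactProper oD scD DT).
Qed.

Lemma openC1 (x : S) : open (~` [set x]).
Proof. by apply: closed_openC; exact: accessible_closed_set1 (hausdorff_accessible hS) x. Qed.

Lemma proper_separates (x y : S) : x <> y ->
  exists2 D : P, sval D x & ~ sval D y.
Proof.
move=> xy; have [|D Dx Dy] := @proper_base x (~` [set y]) (openC1 y) xy.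
  by move=> /seteqP[_ /(_ y I)]; apply.
by exists D => // /Dy; apply.
Qed.

Definition avoiding (x : S) : set P := [set D : P | ~ sval D x].

Lemma avoiding_proper x : proper_ideal (@subset_le S) (avoiding x).
Proof.
split.
- have T0 : set0 <> setT :> set S by move=> /seteqP[_ /(_ x I)].
  by exists (OpenSigmaCompactProper open0 (compact_sigma_compact compact0) T0).
- by move=> a b ab nbx /ab.
- move=> [a [oa sa na]] [b [ob sb nb]] nax nbx.
  have abT : a `|` b <> setT.
    by move=> /seteqP[_ /(_ x I)] [].
  exists (OpenSigmaCompactProper (openU oa ob) (sigma_compactU sa sb) abT).
  by split; [case|exact: subsetUl|exact: subsetUr].
- have [[D Dx]|noD] := pselect (exists D : P, sval D x).
    by left => /seteqP[_ /(_ D I)].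
  (* Every member of the poset misses x, so x is the only point of S. *)
  right => a b.
  have {}noD y : y = x.
    apply: contrapT => yx; have xy : x <> y by move=> xy; apply: yx.
    by have [D Dx _] := proper_separates xy; apply: noD; exists D.
  have emp (c : P) : sval c = set0.
    case: c => c [oc sc nc] /=; apply/seteqP; split=> // y cy; apply: nc.
    by apply/seteqP; split=> // z _; rewrite (noD z) -(noD y).
  by apply: sval_inj; rewrite !emp.
Qed.

(** The members of a proper ideal I do not cover S.  If they did, every compact set
    would lie in a member of I.  For S compact this makes S a member.  For S not
    compact, every D lies in a compact open set, hence in a member of I, so that I
    is the whole poset. *)
Lemma proper_ideal_avoiding (I : set P) :
  proper_ideal (@subset_le S) I -> exists x, I `<=` avoiding x.
Proof.
move=> [I0 Ilow Idir Iprop]; apply: contrapT => noX.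
have Icov : setT `<=` \bigcup_(a in @sval _ _ @` I) a.
  move=> x _; apply: contrapT => nx; apply: noX; exists x => D ID Dx.
  by apply: nx; exists (sval D) => //; exists D.
have bound (K : set S) : compact K -> exists2 D, I D & K `<=` sval D.
  move=> cK.
  have [||||_ [D ID <-] KD] := @compact_directed_cover _ K (@sval _ _ @` I) cK.
  - by have [D ID] := I0; exists (sval D), D.
  - move=> _ _ [a Ia <-] [b Ib <-]; have [c [Ic ac bc]] := Idir _ _ Ia Ib.
    by exists (sval c); [exists c|rewrite subUset].
  - by move=> _ [[D []] ? ? ? _ <-].
  - by apply: subset_trans Icov.
  by exists D.
have [cS|ncS] := pselect (compact [set: S]).
  have [[D [? ? nD]] _ /= TD] := bound _ cS; apply: nD.
  by apply/seteqP; split.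
have cP (K : set S) : compact K -> open K -> K <> setT.
  by move=> cK _ KT; apply: ncS; rewrite -KT.
have [IT|sub] := Iprop.
  apply: IT; apply/seteqP; split=> // D _.
  have [K [cK oK DK]] := bS (let: And3 _ sD _ := svalP D in sD).
  have [E IE KE] := bound _ cK.
  by apply: Ilow IE; exact: subset_trans KE.
have [x _] : [set: S] !=set0.
  by apply: contrapT => /nonemptyPn S0; apply: ncS; rewrite S0; exact: compact0.
have [K [cK oK xK]] := bS (compact_sigma_compact (@compact_set1 _ x)).
have T0 : set0 <> setT :> set S by move=> /seteqP[_ /(_ x Logic.I)].
have := sub (OpenSigmaCompactProper oK (compact_sigma_compact cK) (cP _ cK oK))
  (OpenSigmaCompactProper open0 (compact_sigma_compact compact0) T0).
by move=> /(congr1 sval)/= K0; have := xK x erefl; rewrite K0.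
Qed.

Lemma avoiding_sub_eq x y : avoiding x `<=` avoiding y -> x = y.
Proof.
move=> xy; apply: contrapT => nxy.
have yx : y <> x by move=> yx; apply: nxy.
by have [D Dy nDx] := proper_separates yx; exact: xy Dy.
Qed.

Lemma point_idealP (I : set P) :
  point_ideal (@subset_le S) I <-> exists x, I = avoiding x.
Proof.
split=> [[Iprop Imax]|[x ->]].
  have [x Ix] := proper_ideal_avoiding Iprop; exists x.
  by rewrite (Imax _ (avoiding_proper x) Ix).
split=> [|J Jprop xJ]; first exact: avoiding_proper.
have [y Jy] := proper_ideal_avoiding Jprop.
apply/seteqP; split=> //; suff -> : x = y by [].
by apply: avoiding_sub_eq; exact: subset_trans Jy.
Qed.

End recovery.

Section reconstruction.
Variables (R : realType) (S S' : topologicalType).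
Hypotheses (hS : hausdorff_space S) (bS : sigma_compact_bounded S).
Hypotheses (hS' : hausdorff_space S') (bS' : sigma_compact_bounded S').
Variables (f : open_sigma_compact_proper S -> open_sigma_compact_proper S').
Variables (g : open_sigma_compact_proper S' -> open_sigma_compact_proper S).
Hypotheses (fK : cancel f g) (gK : cancel g f).
Hypothesis fle : forall x y, subset_le x y -> subset_le (f x) (f y).
Hypothesis gle : forall x y, subset_le x y -> subset_le (g x) (g y).

(** The map h sends x to the point whose ideal is the image of the ideal of x. *)
Lemma point_transport : exists h : S -> S',
  forall x (D : open_sigma_compact_proper S'), sval D (h x) <-> sval (g D) x.
Proof.
suff /choice[h hP] : forall x, exists y, forall D : open_sigma_compact_proper S',
    sval D y <-> sval (g D) x by exists h.
move=> x.
have /(point_ideal_preimage fK gK fle gle) : point_ideal (@subset_le S) (avoiding x).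
  by apply/(point_idealP R hS bS); exists x.
move=> /(point_idealP R hS' bS')[y gxy]; exists y => D.
have : avoiding x (g D) <-> avoiding y D.
  by rewrite -gxy.
by rewrite /avoiding /= => -[h1 h2]; split=> ?; apply: contrapT => /[dup]; [move/h1|move/h2].
Qed.

Lemma transport_continuous (h : S -> S') :
  (forall x (D : open_sigma_compact_proper S'), sval D (h x) <-> sval (g D) x) -> continuous h.
Proof.
move=> hP x U /=; rewrite nbhsE => -[V [oV Vhx] VU].
suff : nbhs x (h @^-1` V) by apply: filterS => y; exact: VU.
have [->|VT] := pselect (V = setT); first exact: filterT.
have [D Dhx DV] := proper_base R hS' bS' oV Vhx VT.
apply: (@filterS _ _ _ (sval (g D))); first by move=> y /hP/DV.
by apply: open_nbhs_nbhs; split; [case: (svalP (g D))|apply/hP].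
Qed.

End reconstruction.

Lemma homeomorphic_of_order_isomorphic (R : realType) (S S' : topologicalType) :
  hausdorff_space S -> sigma_compact_bounded S ->
  hausdorff_space S' -> sigma_compact_bounded S' ->
  order_isomorphic (@subset_le S) (@subset_le S') -> homeomorphic S S'.
Proof.
move=> hS bS hS' bS' [f [g [fK gK fle gle]]].
have [h hP] := point_transport R hS bS hS' bS' fK gK fle gle.
have [k kP] := point_transport R hS' bS' hS bS gK fK gle fle.
exists h, k; split.
- exact: (transport_continuous R hS' bS' hP).
- exact: (transport_continuous R hS bS kP).
- move=> x; apply: contrapT => nx.
  have [D Dx nD] := proper_separates R hS bS nx.
  by apply: nD; move/kP/hP : Dx; rewrite fK.
- move=> x; apply: contrapT => nx.
  have [D Dx nD] := proper_separates R hS' bS' nx.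
  by apply: nD; move/hP/kP : Dx; rewrite gK.
Qed.

Lemma order_isomorphic_of_homeomorphic (S S' : topologicalType) :
  homeomorphic S S' -> order_isomorphic (@subset_le S) (@subset_le S').
Proof.
have pre (T T' : topologicalType) (f : T -> T') (g : T' -> T)
    (D : set T) : continuous f -> continuous g -> cancel f g -> cancel g f ->
    [/\ open D, sigma_compact D & D <> setT] ->
    [/\ open (g @^-1` D), sigma_compact (g @^-1` D) & g @^-1` D <> setT].
  move=> cf cg fK gK [oD sD nD]; split.
  - by move/continuousP : cg; apply.
  - rewrite (_ : _ @^-1` _ = f @` D); first exact: sigma_compact_image.
    apply/seteqP; split=> y => [Dy|[x Dx <-]]; last by rewrite /= fK.
    by exists (g y).
  - move=> gDT; apply: nD; apply/seteqP; split=> // x _.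
    have : (g @^-1` D) (f x) by rewrite gDT.
    by rewrite /= fK.
move=> [f [g [cf cg fK gK]]].
exists (fun D => exist _ _ (pre _ _ _ _ _ cf cg fK gK (svalP D))).
exists (fun D => exist _ _ (pre _ _ _ _ _ cg cf gK fK (svalP D))).
split.
- by move=> D; apply: sval_inj; apply/seteqP; split=> x /=; rewrite fK.
- by move=> D; apply: sval_inj; apply/seteqP; split=> x /=; rewrite gK.
- by move=> D E DE x /= /DE.
- by move=> D E DE x /= /DE.
Qed.

(** * Clopen sigma-compact sets in locally compact paracompact spaces *)

Section clopen_hull.
Variable X : topologicalType.
Hypotheses (lcX : locally_compact_space X) (pX : paracompact_space X).

Lemma locally_finite_precompact_cover : exists V : set (set X),
  [/\ V `<=` open, \bigcup_(v in V) v = setT,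
      (forall v, V v -> compact (closure v)) & locally_finite_family V].
Proof.
have [hX lX] := lcX.
have [||V [oV cV Vref lfV]] := pX.2 [set u | open u /\ compact (closure u)].
- by move=> u [].
- apply/seteqP; split=> // x _.
  have [K xK [cK clK]] := lX x I.
  exists K°; last by move: xK; rewrite withinET.
  split; first exact: open_interior.
  apply: (subclosed_compact _ cK); first exact: closed_closure.
  have := @closure_subset _ _ _ (@interior_subset _ K).
  by rewrite -((closure_id K).1 clK).
- exists V; split=> // v /Vref[u [_ cu] vu].
  apply: (subclosed_compact _ cu); first exact: closed_closure.
  exact: closure_subset.
Qed.

Variable V : set (set X).
Hypotheses (oV : V `<=` open) (cV : \bigcup_(v in V) v = setT).
Hypotheses (kV : forall v, V v -> compact (closure v)).
Hypothesis lfV : locally_finite_family V.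

Definition meeting (A : set X) := [set v | V v /\ v `&` A !=set0].

(** Local finiteness: the open sets that meet finitely many members of V cover X
    and are closed under finite unions. *)
Lemma finite_meeting_compact K : compact K -> finite_set (meeting K).
Proof.
move=> cK.
have [||||N [_ fN] KN] := @compact_directed_cover _ K
   [set N | open N /\ finite_set (meeting N)] cK.
- exists set0; split; first exact: open0.
  rewrite (_ : meeting _ = set0)//; apply/seteqP; split=> // v [_ [x []]] //.
- move=> a b [oa fa] [ob fb]; exists (a `|` b) => //; split; first exact: openU.
  apply: (@sub_finite_set _ _ (meeting a `|` meeting b)); last by rewrite finite_setU.
  by move=> v [Vv [x [vx [ax|bx]]]]; [left|right]; split=> //; exists x.
- by move=> a [].
- move=> x _; have [N xN fN] := lfV x; exists N°; last exact: xN.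
  split; first exact: open_interior.
  apply: (sub_finite_set _ fN) => v [Vv [y [vy Ny]]]; split=> //; exists y.
  by split=> //; exact: interior_subset.
apply: (sub_finite_set _ fN) => v [Vv [y [vy Ky]]]; split=> //; exists y.
by split=> //; exact: KN.
Qed.

Lemma countable_meeting_sigma_compact A :
  sigma_compact A -> countable (meeting A).
Proof.
move=> [K cK ->].
rewrite (_ : meeting _ = \bigcup_n meeting (K n)).
  apply: bigcup_countable => // n _; apply: finite_set_countable.
  exact: finite_meeting_compact.
apply/seteqP; split=> v => [[Vv [x [vx [n _ Kx]]]]|[n _ [Vv [x [vx Kx]]]]].
  by exists n => //; split=> //; exists x.
by split=> //; exists x; split=> //; exists n.
Qed.

(** The n-th step lists the members of V that end a chain of n + 1 members, the
    first meeting A and each other one meeting the closure of its predecessor.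
    As a compact closure meets finitely many members of V, each step is countable
    when A is sigma-compact. *)
Fixpoint hull_step (A : set X) n : set (set X) :=
  if n is m.+1 then meeting (\bigcup_(v in hull_step A m) closure v)
  else meeting A.

Lemma hull_step_sub A n : hull_step A n `<=` V.
Proof. by case: n => [|n] v []. Qed.

Lemma countable_hull_step A n : sigma_compact A -> countable (hull_step A n).
Proof.
move=> sA; elim: n => [|n IH] /=; apply: countable_meeting_sigma_compact => //.
apply: sigma_compact_bigcup => // v /hull_step_sub Vv.
by apply: compact_sigma_compact; exact: kV.
Qed.

(** The union B of all the steps from A is open, and a member of V that meets B
    appears at a later step, so the complement of B is a union of members of V. *)
Lemma clopen_hull_from_cover A : sigma_compact A ->
  exists B : set X, [/\ open B, closed B, sigma_compact B & A `<=` B].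
Proof.
move=> sA; pose C := \bigcup_n hull_step A n.
have CV : C `<=` V by move=> v [n _ /hull_step_sub].
have Cmeet v w : V v -> C w -> v `&` w !=set0 -> C v.
  move=> Vv [n _ Cw] [x [vx wx]]; exists n.+1 => //=; split=> //; exists x.
  by split=> //; exists w => //; exact: subset_closure.
pose B := \bigcup_(v in C) v.
have oB : open B by apply: bigcup_open => v /CV/oV.
have clB : closed B.
  rewrite -openC (_ : ~` B = \bigcup_(v in [set v | V v /\ v `&` B = set0]) v).
    by apply: bigcup_open => v [/oV].
  apply/seteqP; split=> x => [nBx|[v [_ vB] vx] Bx]; last first.
    by have : (v `&` B) x by []; rewrite vB.
  have [v Vv vx] : (\bigcup_(v in V) v) x by rewrite cV.
  exists v => //; split=> //; apply: contrapT => /eqP/set0P[y [vy [w Cw wy]]].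
  by apply: nBx; exists v => //; apply: (Cmeet _ w) => //; exists y.
exists B; split=> //.
- rewrite (_ : B = \bigcup_(v in C) closure v).
    apply: sigma_compact_bigcup.
      by apply: bigcup_countable => // n _; exact: countable_hull_step.
    by move=> v /CV Vv; apply: compact_sigma_compact; exact: kV.
  apply/seteqP; split=> x [v Cv vx].
    by exists v => //; exact: subset_closure.
  rewrite ((closure_id B).1 clB); apply: closure_subset vx => y vy.
  by exists v.
- move=> x Ax; have [v Vv vx] : (\bigcup_(v in V) v) x by rewrite cV.
  by exists v => //; exists 0%N => //; split=> //; exists x.
Qed.

(** A closed noncompact Z meets infinitely many members of V.  Choose one point of
    Z in each of countably many of them; a clopen hull B of these points meets Z in
    a set that still meets infinitely many members of V. *)
Lemma noncompact_hull_from_cover Z : closed Z -> ~ compact Z ->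
  exists B : set X, [/\ open B, closed B, sigma_compact B & ~ compact (B `&` Z)].
Proof.
move=> clZ ncZ.
have infZ : infinite_set (meeting Z).
  move=> finZ; apply: ncZ.
  have cU : compact (\bigcup_(v in meeting Z) closure v).
    rewrite -bigsetU_fset_set // big_seq; apply: bigsetU_compact => v.
    by rewrite in_fset_set ?inE// => -[/kV].
  apply: (subclosed_compact clZ cU) => x Zx.
  have [v Vv vx] : (\bigcup_(v in V) v) x by rewrite cV.
  by exists v; [split=> //; exists x|exact: subset_closure].
have [g gP ginj] : exists2 g : nat -> set X, forall n, meeting Z (g n) & injective g.
  move/infiniteP/pcard_leP/unsquash : infZ => g; exists g.
    by move=> n; apply: (@funS _ _ _ _ g).
  by move=> m n; apply: (@inj _ _ _ g); rewrite inE.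
have /choice[x xP] : forall n, exists x, (g n `&` Z) x.
  by move=> n; have [_ [x]] := gP n; exists x.
have sA : sigma_compact (range x).
  exists (fun n => [set x n]) => [n|]; first exact: compact_set1.
  by apply/seteqP; split=> y [n _ xn]; exists n.
have [B [oB clB sB AB]] := clopen_hull_from_cover sA.
exists B; split=> // /finite_meeting_compact fBZ.
apply: infinite_nat; apply: (@sub_finite_set _ _ (g @^-1` meeting (B `&` Z))).
  move=> n _; have [Vg _] := gP n; have [gx Zx] := xP n.
  by split=> //; exists (x n); split=> //; split=> //; apply: AB; exists n.
apply: finite_preimage => //.
by move=> m n _ _; exact: ginj.
Qed.

End clopen_hull.

Lemma clopen_sigma_compact_hull (X : topologicalType) (A : set X) :
  locally_compact_space X -> paracompact_space X -> sigma_compact A ->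
  exists B : set X, [/\ open B, closed B, sigma_compact B & A `<=` B].
Proof.
move=> lcX pX; have [V [oV cV kV lfV]] := locally_finite_precompact_cover lcX pX.
exact: (clopen_hull_from_cover oV cV kV lfV).
Qed.

Lemma noncompact_clopen_sigma_compact (X : topologicalType) (Z : set X) :
  locally_compact_space X -> paracompact_space X -> closed Z -> ~ compact Z ->
  exists B : set X, [/\ open B, closed B, sigma_compact B & ~ compact (B `&` Z)].
Proof.
move=> lcX pX; have [V [oV cV kV lfV]] := locally_finite_precompact_cover lcX pX.
exact: (noncompact_hull_from_cover oV cV kV lfV).
Qed.

(** * The Stone-Cech compactification of a locally compact paracompact space *)

Section stone_cech_of_locally_compact.
Variables (R : realType) (X : topologicalType).
Hypothesis lcX : locally_compact_space X.
Local Notation bX := (stone_cech R X).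
Local Notation b := (@to_stone_cech R X).
Local Notation cl A := (closure (b @` A)).

Lemma stone_cech_embedding : topological_embedding b.
Proof. exact/to_stone_cech_embedding/locally_compact_tychonoff. Qed.

Lemma stone_cech_open_map (U : set X) : open U -> open (b @` U).
Proof.
move=> oU; apply: (dense_embedding_open stone_cech_embedding) => //.
  exact: to_stone_cech_dense.
exact: stone_cech_hausdorff.
Qed.

Lemma open_range_stone_cech : open (range b).
Proof. exact/stone_cech_open_map/openT. Qed.

Lemma closed_stone_cech_compact (K : set bX) : closed K -> compact K.
Proof. by move=> clK; apply: (subclosed_compact clK (@stone_cech_compact R X)). Qed.

Lemma cl_compact (A : set X) : compact (cl A).
Proof. exact/closed_stone_cech_compact/closed_closure. Qed.

Lemma cl_cover (A : set X) : cl A `|` cl (~` A) = setT.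
Proof.
apply/seteqP; split=> // z _; rewrite -closureU -image_setU setUv.
have := @dense_closure_preimage _ _ b (@to_stone_cech_dense R X) z setT.
by rewrite preimage_setT; apply; exact: filterT.
Qed.

(** The indicator function of a clopen set B extends continuously to bX, and the
    closure of B is the set where the extension is larger than 1/2. *)
Lemma cl_open (B : set X) : open B -> closed B -> open (cl B).
Proof.
move=> oB clB.
have cf : continuous (\1_B : X -> R).
  apply/continuousP => A _; rewrite preimage_indic.
  case: ifP => _; case: ifP => _; [exact: openT|by []| |exact: open0].
  exact: closed_openC.
have [|g cg gB] := stone_cech_extension cf.
  by move=> x; rewrite indicE; case: (_ \in _); rewrite !lexx ler01.
have gE x : g (b x) = \1_B x by rewrite -gB.
have -> : cl B = g @^-1` [set r | 2^-1 < r].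
  apply/seteqP; split=> z; last first.
    move=> gz; have : nbhs z (g @^-1` [set r | 2^-1 < r]).
      apply: open_nbhs_nbhs; split=> //.
      by move/continuousP : cg; apply; exact: open_gt.
    move=> /(dense_closure_preimage (@to_stone_cech_dense R X)).
    apply: closure_subset => _ [x /= gx <-]; exists x => //.
    apply: contrapT => nBx; move: gx; rewrite gE indicE memNset// ltNge.
    by rewrite invr_ge0 ler0n.
  have clg : closed (g @^-1` [set r | 1 <= r]).
    by move/continuous_closedP : cg; apply; exact: closed_ge.
  have Bg : b @` B `<=` g @^-1` [set r | 1 <= r].
    by move=> _ [x Bx <-] /=; rewrite gE indicE mem_set.
  move=> /(closure_subset Bg); rewrite -((closure_id _).1 clg) /=.
  by apply: lt_le_trans; rewrite invf_lt1 ?ltr1n.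
by move/continuousP : cg; apply; exact: open_gt.
Qed.

Lemma open_cl_disjoint (U : set bX) (A : set X) :
  open U -> (forall x, A x -> ~ U (b x)) -> forall z, U z -> ~ cl A z.
Proof.
move=> oU AU z Uz clz; have [|_ [[x Ax <-] Ux]] := clz U.
  exact: open_nbhs_nbhs.
exact: AU Ux.
Qed.

Lemma sigma_extension_cl (A : set X) :
  sigma_compact A -> cl A `<=` @sigma_extension R X.
Proof. by move=> sA z Az; exists A. Qed.

Lemma range_sigma_extension : range b `<=` @sigma_extension R X.
Proof.
move=> _ [x _ <-]; exists [set x].
  exact: (compact_sigma_compact (@compact_set1 _ x)).
by apply: subset_closure; exists x.
Qed.

Hypothesis pX : paracompact_space X.

(** The closures in bX of the clopen sigma-compact subsets of X are open, directed,
    and cover sX. *)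
Lemma compact_in_sigma_extension (K : set bX) :
  compact K -> K `<=` @sigma_extension R X ->
  exists B : set X, [/\ open B, closed B, sigma_compact B & K `<=` cl B].
Proof.
move=> cK Ks.
pose G := [set C | exists B : set X,
  [/\ open B, closed B, sigma_compact B & C = cl B] ].
have [||||C [B [oB clB sB ->]] KB] := @compact_directed_cover _ K G cK.
- exists (cl set0), set0; split; [exact: open0|exact: closed0| |by []].
  exact: (compact_sigma_compact compact0).
- move=> _ _ [B1 [p1 c1 s1 ->]] [B2 [p2 c2 s2 ->]].
  exists (cl (B1 `|` B2)); last by rewrite image_setU closureU.
  exists (B1 `|` B2); split=> //; first exact: openU.
    exact: closedU.
  exact: sigma_compactU.
- by move=> _ [B [oB clB _ ->]]; exact: cl_open.
- move=> z /Ks[A sA Az].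
  have [B [oB clB sB AB]] := clopen_sigma_compact_hull lcX pX sA.
  exists (cl B); first by exists B.
  by apply: closure_subset Az; exact: image_subset.
by exists B.
Qed.

Lemma sigma_compact_in_sigma_extension (K : set bX) :
  sigma_compact K -> K `<=` @sigma_extension R X ->
  exists B : set X, [/\ open B, closed B, sigma_compact B & K `<=` cl B].
Proof.
move=> [F cF ->] Fs.
have /choice[C CP] : forall n, exists B : set X,
    [/\ open B, closed B, sigma_compact B & F n `<=` cl B].
  move=> n; apply: compact_in_sigma_extension => //.
  by apply: subset_trans Fs; exact: bigcup_sup.
have sC : sigma_compact (\bigcup_n C n).
  by apply: sigma_compact_bigcup => // n _; case: (CP n).
have [B [oB clB sB CB]] := clopen_sigma_compact_hull lcX pX sC.
exists B; split=> // z [n _ Fz].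
have [_ _ _ /(_ z Fz)] := CP n.
by apply/closure_subset/image_subset => x Cx; apply: CB; exists n.
Qed.

Lemma open_sigma_extension : open (@sigma_extension R X).
Proof.
rewrite openE => z [A sA Az].
have [B [oB clB sB AB]] := clopen_sigma_compact_hull lcX pX sA.
apply: (@filterS _ _ _ (cl B)); first exact: sigma_extension_cl.
apply: open_nbhs_nbhs; split; first exact: cl_open.
by apply: closure_subset Az; exact: image_subset.
Qed.

Lemma sigma_remainder_hausdorff : hausdorff_space (sigma_remainder R X).
Proof. exact/hausdorff_set_type/stone_cech_hausdorff. Qed.

(** If B is clopen in X then cl B \ X is open in S, and compact since X is open in
    bX. *)
Lemma sigma_remainder_bounded : sigma_compact_bounded (sigma_remainder R X).
Proof.
move=> A sA; pose v : sigma_remainder R X -> bX := set_val.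
have ev : topological_embedding v := set_val_embedding _.
have cv : continuous v := embedding_continuous ev.
have [|B [oB clB sB AB]] :=
    sigma_compact_in_sigma_extension (sigma_compact_image cv sA).
  by move=> _ [x _ <-]; have [] := set_valP x.
exists (v @^-1` cl B); split; last by move=> x Ax; apply: AB; exists x.
- apply: (embedding_compact ev).
  rewrite (_ : _ @` _ = cl B `&` ~` range b).
    apply: compact_closedI; first exact: cl_compact.
    exact/open_closedC/open_range_stone_cech.
  apply/seteqP; split=> z => [[x Bx <-]|[Bz nz]].
    by split=> //; have [] := set_valP x.
  have Sz : (@sigma_extension R X `\` range b) z.
    by split=> //; exact: sigma_extension_cl Bz.
  by exists (exist _ z (mem_set Sz)).
- by move/continuousP : cv; apply; exact: cl_open.
Qed.

(** If S is sigma-compact, then S lies in cl B for some clopen sigma-compact B, and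
    X \ B has to be compact: otherwise X \ B contains a noncompact closed subset Z of
    a sigma-compact set, and cl Z has a point in S outside cl B.  Hence X is
    sigma-compact. *)
Lemma sigma_compact_remainder :
  sigma_compact [set: sigma_remainder R X] -> @sigma_extension R X = setT.
Proof.
move=> sS; pose v : sigma_remainder R X -> bX := set_val.
have cv : continuous v := embedding_continuous (set_val_embedding _).
have [|B [oB clB sB SB]] :=
    sigma_compact_in_sigma_extension (sigma_compact_image cv sS).
  by move=> _ [x _ <-]; have [] := set_valP x.
have {}SB z : @sigma_extension R X z -> ~ range b z -> cl B z.
  move=> sz nz; apply: SB; have Sz : (@sigma_extension R X `\` range b) z by [].
  by exists (exist _ z (mem_set Sz)).
have cCB : compact (~` B).
  apply: contrapT => ncB.
  have [B' [oB' clB' sB' ncZ]] :=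
    noncompact_clopen_sigma_compact lcX pX (open_closedC oB) ncB.
  pose Z := B' `&` ~` B.
  have clZ : closed Z by apply: closedI => //; exact: open_closedC.
  have [z Zz nz] : exists2 z, cl Z z & ~ range b z.
    apply: contrapT => noz; apply: ncZ.
    apply: (embedding_compact stone_cech_embedding).
    rewrite (_ : _ @` _ = cl Z); first exact: cl_compact.
    apply/seteqP; split; first exact: subset_closure.
    move=> z Zz; apply: contrapT => nZz; apply: noz; exists z => // -[x _ xz].
    apply: nZz; exists x => //.
    have : (b @^-1` cl Z) x by rewrite /= xz.
    by rewrite (embedding_closure_preimage stone_cech_embedding clZ).
  have sz : @sigma_extension R X z.
    apply: (sigma_extension_cl sB'); apply: closure_subset Zz.
    by apply: image_subset => x [].
  apply: (open_cl_disjoint (cl_open oB clB) _ (SB _ sz nz) Zz).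
  move=> x [_ nBx] clBx; apply: nBx; move: clBx.
  by rewrite -[X in X -> _]/((b @^-1` cl B) x)
    (embedding_closure_preimage stone_cech_embedding clB).
apply/seteqP; split=> // z _.
have [Bz|Bz] : (cl B `|` cl (~` B)) z by rewrite cl_cover.
  exact: sigma_extension_cl Bz.
exact: (sigma_extension_cl (compact_sigma_compact cCB)) Bz.
Qed.

End stone_cech_of_locally_compact.

(** * One-point extensions and open subsets of the Stone-Cech compactification *)

Lemma hausdorff_separate (T : topologicalType) (x y : T) :
  hausdorff_space T -> x <> y ->
  exists A B : set T, [/\ open A, open B, A x, B y & A `&` B = set0].
Proof.
rewrite open_hausdorff => hT /eqP xy; have [[A B] /= [xA yB] [oA oB /eqP AB]] := hT _ _ xy.
by exists A, B; split=> //; exact: set_mem.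
Qed.

Lemma notin_closure (T : topologicalType) (A : set T) (x : T) :
  ~ closure A x -> exists U, [/\ open U, U x & U `&` A = set0].
Proof.
move=> nx; exists (~` closure A); split=> //.
  exact/closed_openC/closed_closure.
apply/seteqP; split=> // y [nA Ay]; apply: nA; exact: subset_closure.
Qed.

Lemma open_notin_closure (T : topologicalType) (U A : set T) (x : T) :
  open U -> U x -> U `&` A = set0 -> ~ closure A x.
Proof.
move=> oU Ux UA clx; have [|y [Ay Uy]] := clx U; first exact: open_nbhs_nbhs.
by have : (U `&` A) y by []; rewrite UA.
Qed.

Section one_point_extensions.
Variables (R : realType) (X : topologicalType).
Hypothesis lcX : locally_compact_space X.
Local Notation bX := (stone_cech R X).
Local Notation b := (@to_stone_cech R X).
Local Notation cl A := (closure (b @` A)).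
Implicit Type T : one_point_extension X.

Definition apex T : T := projT1 (cid (ext_singleton T)).

Lemma apexE T : ~` range (ext_map T) = [set apex T].
Proof. by rewrite /apex; case: cid. Qed.

Lemma ext_map_apex T x : ext_map T x <> apex T.
Proof.
move=> xp; have : (~` range (ext_map T)) (apex T) by rewrite apexE.
by apply; exists x.
Qed.

Lemma ext_cases T (t : T) : t = apex T \/ exists x, t = ext_map T x.
Proof.
have [[x _ <-]|nt] := pselect (range (ext_map T) t); first by right; exists x.
by left; have : (~` range (ext_map T)) t by []; rewrite apexE.
Qed.

Lemma ext_hausdorff T : hausdorff_space T.
Proof. by have [] := ext_tychonoff T. Qed.

Lemma ext_map_continuous T : continuous (ext_map T).
Proof. exact/embedding_continuous/ext_embedding. Qed.

Lemma ext_map_open T (U : set X) : open U -> open (ext_map T @` U).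
Proof.
apply: dense_embedding_open => //; [exact: ext_embedding|exact: ext_dense|].
exact: ext_hausdorff.
Qed.

(** The complement in bX of the fibre of the added point under the canonical map
    from bX to the compactification of T (see [stone_cech_map_apex]), described
    without that map. *)
Definition away T : set bX :=
  [set z | exists2 W, nbhs z W & ~ closure (ext_map T @` (b @^-1` W)) (apex T)].

Lemma open_away T : open (away T).
Proof.
rewrite openE => z [W zW nW]; apply: filterS (nbhs_interior zW) => y yW.
by exists W.
Qed.

Lemma range_away T : range b `<=` away T.
Proof.
move=> _ [x _ <-].
have [A [C [oA oC Ax Cp AC]]] :=
  hausdorff_separate (@ext_hausdorff T) (@ext_map_apex T x).
exists (b @` (ext_map T @^-1` A)).
  apply: open_nbhs_nbhs; split; last by exists x.
  apply: stone_cech_open_map => //.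
  by have /continuousP := @ext_map_continuous T; apply.
apply: (open_notin_closure oC) => //; apply/seteqP; split=> // z [Cz [y [y' Ay' yy'] yz]].
have [binj _] := stone_cech_embedding R lcX.
by rewrite -AC; split=> //; rewrite -yz -(binj _ _ yy').
Qed.

(** From left to right, separate p from A by a function on T and extend its
    restriction to X to bX.  From right to left, use the compactness of the closure
    of A in bX. *)
Lemma notin_closure_awayP T (A : set X) :
  ~ closure (ext_map T @` A) (apex T) <-> cl A `<=` away T.
Proof.
split=> [nA z Az|clA].
  have [_ crT] := ext_tychonoff T.
  have [g [cg g01 g0 g1]] : exists g : T -> R, [/\ continuous g,
      (range g `<=` `[0%R, 1%R]), g @` [set apex T] `<=` [set 0] &
      g @` closure (ext_map T @` A) `<=` [set 1]].
    by apply/uniform_separatorP; apply: crT => //; exact: closed_closure.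
  have cgj : continuous (g \o ext_map T).
    by move=> x; apply: continuous_comp; [exact: ext_map_continuous|exact: cg].
  have [|G cG Gb] := stone_cech_extension cgj.
    by move=> x; have /= := g01 _ (imageT g (ext_map T x)); rewrite in_itv.
  have GE x : G (b x) = g (ext_map T x) by exact: (congr1 (fun h => h x) Gb).
  have Gz : 1 <= G z.
    have clG : closed (G @^-1` [set r | 1 <= r]).
      by move/continuous_closedP : cG; apply; exact: closed_ge.
    have AG : b @` A `<=` G @^-1` [set r | 1 <= r].
      move=> _ [x Ax <-] /=; rewrite GE (g1 (g (ext_map T x)))//.
      by exists (ext_map T x) => //; apply: subset_closure; exists x.
    by move: Az => /(closure_subset AG); rewrite -((closure_id _).1 clG).
  (* G >= 1 at z, while g < 1/2 near p. *)
  exists (G @^-1` [set r | 2^-1 < r]).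
    apply: open_nbhs_nbhs; split.
      by move/continuousP : cG; apply; exact: open_gt.
    by apply: lt_le_trans Gz; rewrite invf_lt1 ?ltr1n.
  apply: (@open_notin_closure _ (g @^-1` [set r | r < 2^-1])).
  - by move/continuousP : cg; apply; exact: open_lt.
  - by rewrite /= (g0 (g (apex T))) ?invr_gt0//; exists (apex T).
  - apply/seteqP; split=> // _ [/[swap] [[x /= Gx <-]]] /=.
    by rewrite -GE => /(lt_trans Gx); rewrite ltxx.
pose G := [set W : set bX | open W /\
  ~ closure (ext_map T @` (b @^-1` W)) (apex T)].
have [|||||W [oW nW] AW] := @compact_directed_cover _ (cl A) G.
- exact: cl_compact.
- exists set0; split; first exact: open0.
  by rewrite preimage_set0 image_set0 closure0.
- move=> V W [oV nV] [oW nW]; exists (V `|` W) => //; split; first exact: openU.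
  by rewrite preimage_setU image_setU closureU => -[].
- by move=> W [].
- move=> z /clA[W zW nW]; exists W°; last exact: zW.
  split; first exact: open_interior.
  by apply: contra_not nW; apply/closure_subset/image_subset => x /interior_subset.
apply: contra_not nW; apply/closure_subset/image_subset => x Ax.
by apply: AW; apply: subset_closure; exists x.
Qed.

Lemma away_neqT T : away T <> setT.
Proof.
move=> aT; have /notin_closure_awayP : cl setT `<=` away T by rewrite aT.
move=> /notin_closure[U [oU Up UX]].
have [|y Uy] := @ext_dense _ T U _ oU; first by exists (apex T).
by move: Uy; rewrite UX.
Qed.

(** A map fixing X sends p1 to p2: if it sent p1 to a point x of X, the points of X
    near p1 in T1 would be close to x in X, hence in T1. *)
Lemma ext_le_apex T1 T2 (f : T1 -> T2) : continuous f ->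
  (forall x, f (ext_map T1 x) = ext_map T2 x) -> f (apex T1) = apex T2.
Proof.
move=> cf fj; have [//|[x fx]] := ext_cases (f (apex T1)).
have [A [C [oA oC Ax Cp AC]]] :=
  hausdorff_separate (@ext_hausdorff T1) (@ext_map_apex T1 x).
have oV : open (ext_map T2 @` (ext_map T1 @^-1` A)).
  by apply: ext_map_open; have /continuousP := @ext_map_continuous T1; apply.
have oD : open (f @^-1` (ext_map T2 @` (ext_map T1 @^-1` A)) `&` C).
  by apply: openI => //; move/continuousP : cf; apply.
have [|_ [/[swap] [[y _ <-]] [[y' Ay' /esym yy'] Cy]]] := @ext_dense _ T1 _ _ oD.
  by exists (apex T1); split=> //=; rewrite fx; exists x.
have [jinj _] := ext_embedding T2.
have : (A `&` C) (ext_map T1 y) by split=> //; rewrite (jinj y y')// -fj.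
by rewrite AC.
Qed.

(** For the converse, the only map that fixes X and sends p1 to p2 is continuous at
    p1: the part of X outside a neighbourhood of p2 has its closure in [away T2],
    hence in [away T1], so it does not accumulate at p1. *)
Lemma ext_leP T1 T2 : ext_le T2 T1 <-> away T2 `<=` away T1.
Proof.
split=> [[f cf fj] z [W zW nW]|aa].
  exists W => //; have [U [oU Up UW]] := notin_closure nW.
  apply: (@open_notin_closure _ (f @^-1` U)).
  - by move/continuousP : cf; apply.
  - by rewrite /= (ext_le_apex cf fj).
  - apply/seteqP; split=> // _ [/[swap] [[x Wx <-]]]; rewrite /= fj => Ux.
    suff : (U `&` ext_map T2 @` (b @^-1` W)) (ext_map T2 x) by rewrite UW.
    by split=> //; exists x.
have /choice[f fP] : forall t : T1, exists s : T2,
    (t = apex T1 -> s = apex T2) /\ (forall x, t = ext_map T1 x -> s = ext_map T2 x).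
  move=> t; have [->|[x ->]] := ext_cases t.
    by exists (apex T2); split=> // x /esym/ext_map_apex.
  exists (ext_map T2 x); split=> [/ext_map_apex//|y].
  by have [jinj _] := ext_embedding T1 => /jinj ->.
exists f; last by move=> x; have [_ /(_ x erefl)] := fP (ext_map T1 x).
apply/continuousP => V oV; rewrite openE => t Vt.
have [tp|[x tx]] := ext_cases t; last first.
  apply: (@filterS _ _ _ (ext_map T1 @` (ext_map T2 @^-1` V))).
    by move=> _ [y Vy <-] /=; have [_ /(_ y erefl) ->] := fP (ext_map T1 y).
  apply: open_nbhs_nbhs; split.
    by apply: ext_map_open; have /continuousP := @ext_map_continuous T2; apply.
  by exists x => //=; have [_ /(_ x tx) <-] := fP t.
have Vp : V (apex T2) by rewrite -(fP t).1.
have : ~ closure (ext_map T2 @` (~` (ext_map T2 @^-1` V))) (apex T2).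
  apply: (open_notin_closure oV Vp); apply/seteqP; split=> //.
  by move=> _ [/[swap] [[x nVx <-]]].
move=> /notin_closure_awayP/subset_trans/(_ aa)/notin_closure_awayP.
move=> /notin_closure[N [oN Np NA]].
rewrite /interior tp; apply: (@filterS _ _ _ N); last exact: open_nbhs_nbhs.
move=> s Ns /=; have [sp|[x sx]] := ext_cases s; first by rewrite (fP s).1.
have [_ /(_ x sx) ->] := fP s; apply: contrapT => nVx.
have : (N `&` ext_map T1 @` (~` (ext_map T2 @^-1` V))) s by split=> //; exists x.
by rewrite NA.
Qed.

End one_point_extensions.

(** * Lindelof and Cech-complete extensions *)

Lemma compact_countable_subcover (T : topologicalType) (K : set T)
    (U : set (set T)) :
  compact K -> U `<=` open -> K `<=` \bigcup_(u in U) u ->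
  exists V, [/\ V `<=` U, countable V & K `<=` \bigcup_(v in V) v].
Proof.
move=> cK oU KU.
pose G := [set w | exists V, [/\ V `<=` U, countable V & w = \bigcup_(v in V) v] ].
have [||||_ [V [VU cV ->]] KV] := @compact_directed_cover _ K G cK.
- by exists set0, set0; split=> //; rewrite bigcup_set0.
- move=> _ _ [V1 [VU1 c1 ->]] [V2 [VU2 c2 ->]].
  exists (\bigcup_(v in V1 `|` V2) v); last by rewrite bigcup_setU.
  exists (V1 `|` V2); split=> //; first by rewrite subUset.
  by rewrite -bigcup2E; apply: bigcup_countable => // -[|[|n]] _ //=; exact: countable0.
- by move=> _ [V [VU _ ->]]; apply: bigcup_open => v /VU/oU.
- move=> x /KU[u Uu ux]; exists (\bigcup_(v in [set u]) v); last by exists u.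
  by exists [set u]; split=> [_ ->//||//]; exact: countable1.
by exists V.
Qed.

Section lindelof_extensions.
Variables (R : realType) (X : topologicalType).
Hypotheses (lcX : locally_compact_space X) (pX : paracompact_space X).
Local Notation bX := (stone_cech R X).
Local Notation b := (@to_stone_cech R X).
Local Notation cl A := (closure (b @` A)).
Implicit Type T : one_point_extension X.

(** If W is a neighbourhood of z whose trace on X does not accumulate at p, the
    closure C of that trace in T is a Lindelof subset of the locally compact X, so
    countably many compact sets cover it. *)
Lemma lindelof_away T :
  lindelof_space T -> away T `<=` @sigma_extension R X.
Proof.
move=> lT z [W zW nW]; pose j := ext_map T.
pose C := closure (j @` (b @^-1` W)).
have oC : open (~` C) by exact/closed_openC/closed_closure.
(* A cover of T by the complement of C and relatively compact open sets. *)
pose U := [set u : set T | open u /\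
  (u = ~` C \/ exists2 K, compact K & u `<=` j @` K)].
have [||V [VU cV Vcov]] := lT U; first by move=> u [].
  apply/seteqP; split=> // t _; have [->|[x ->]] := ext_cases t.
    by exists (~` C) => //; split=> //; left.
  have [_ lX] := lcX; have [K xK [cK clK]] := lX x I.
  exists (j @` K°); last by exists x => //; move: xK; rewrite withinET.
  split; first exact/(ext_map_open lcX)/open_interior.
  by right; exists K => //; apply: image_subset; exact: interior_subset.
have /choice[K KP] : forall v, exists K, compact K /\ (V v -> v = ~` C \/ v `<=` j @` K).
  move=> v; have [/VU[_ [->|[K cK vK]]]|nVv] := pselect (V v).
  - by exists set0; split; [exact: compact0|left].
  - by exists K; split=> // _; right.
  - by exists set0; split; [exact: compact0|].
pose A := \bigcup_(v in V) K v.
have sA : sigma_compact A.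
  apply: sigma_compact_bigcup => // v _.
  by apply: compact_sigma_compact; case: (KP v).
apply: (sigma_extension_cl sA).
apply: (closure_subset _ (dense_closure_preimage (@to_stone_cech_dense R X) zW)).
apply: image_subset => x Wx.
have [v Vv vx] : (\bigcup_(v in V) v) (j x) by rewrite Vcov.
have [_ /(_ Vv)[vC|vK]] := KP v.
  by move: vx; rewrite vC => -[]; apply: subset_closure; exists x.
have [y Ky yx] := vK _ vx; have [jinj _] := ext_embedding T.
by exists v => //; rewrite -(jinj _ _ yx).
Qed.

(** A member of the cover that contains p misses only a set A whose closure in bX is
    a compact subset of sX, so that A lies in a sigma-compact set. *)
Lemma away_lindelof T :
  away T `<=` @sigma_extension R X -> lindelof_space T.
Proof.
move=> aT U oU Ucov; pose j := ext_map T.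
have [u0 Uu0 u0p] : (\bigcup_(u in U) u) (apex T) by rewrite Ucov.
pose A := ~` (j @^-1` u0).
have : ~ closure (j @` A) (apex T).
  apply: (open_notin_closure (oU _ Uu0) u0p); apply/seteqP; split=> //.
  by move=> _ [/[swap] [[x nux <-]]].
move=> /(@notin_closure_awayP R X T A)/subset_trans/(_ aT).
move=> /(compact_in_sigma_extension lcX pX (@cl_compact R X A)).
move=> [B [oB clB [F cF BF] AB]].
have AB' : A `<=` B.
  move=> x Ax; have : (b @^-1` cl B) x.
    by apply: AB; apply: subset_closure; exists x.
  by rewrite (embedding_closure_preimage (stone_cech_embedding R lcX) clB).
have /choice[V VP] : forall n, exists V, [/\ V `<=` U, countable V &
    j @` F n `<=` \bigcup_(v in V) v].
  move=> n; apply: compact_countable_subcover => //.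
    apply: continuous_compact => //.
    exact/continuous_subspaceT/ext_map_continuous.
  by rewrite Ucov.
exists ([set u0] `|` \bigcup_n V n); split.
- by move=> v [->//|[n _ Vv]]; have [VU _ _] := VP n; exact: VU.
- rewrite -bigcup2E; apply: bigcup_countable => // -[|[|n]] _ //=.
    by apply: bigcup_countable => // n _; have [] := VP n.
- apply/seteqP; split=> // t _; have [->|[x ->]] := ext_cases t.
    by exists u0 => //; left.
  have [u0x|nu0x] := pselect (u0 (j x)); first by exists u0 => //; left.
  have : B x by exact: AB'.
  rewrite BF => -[n _ Fx]; have [_ _ Vcov] := VP n.
  have [|v Vv vx] := Vcov (j x); first by exists x.
  by exists v => //; right; exists n.
Qed.

End lindelof_extensions.

Lemma continuous_to_prod (Y : topologicalType) (I : Type) (K : I -> topologicalType)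
    (f : Y -> prod_topology K) :
  (forall i, continuous (fun y => f y i)) -> continuous f.
Proof.
move=> cf y; apply/cvg_sup => i U [_ [[W oW <-] Wz] WU].
have yW : nbhs y [set z | W (f z i)] := cf i y W (open_nbhs_nbhs (conj oW Wz)).
by apply: (@filterS _ (nbhs y) _ _ _ _ yW) => z Wfz; exact: WU.
Qed.

Section stone_cech_functor.
Variables (R : realType) (X T : topologicalType) (f : X -> T).
Hypothesis cf : continuous f.

Lemma unit_map_comp (h : @unit_map R T) : unit_map (set_val h \o f).
Proof.
have [ch h01] : unit_map (set_val h) by exact: set_valP.
by split=> [x|x]; [apply: continuous_comp; [exact: cf|exact: ch]|exact: h01].
Qed.

(** The map from bX to bT is a reindexing of coordinates: the coordinate h of the
    image is the coordinate h \o f of the argument. *)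
Definition pull (h : @unit_map R T) : @unit_map R X :=
  exist _ (set_val h \o f) (mem_set (unit_map_comp h)).

Definition cube_map (z : cube R X) : cube R T := fun h => z (pull h).

Lemma cube_map_continuous : continuous cube_map.
Proof.
apply: (@continuous_to_prod _ _ (fun _ : @unit_map R T => R)) => h.
exact: (@proj_continuous _ (fun _ : @unit_map R X => R) (pull h)).
Qed.

Lemma cube_map_closure (z : stone_cech R X) :
  closure (range (@eval_cube R T)) (cube_map (set_val z)).
Proof.
move=> N /cube_map_continuous zN.
have [_ [[x _ <-] Nx]] := set_valP z (cube_map @^-1` N) zN.
by exists (@eval_cube R T (f x)); split; [exists (f x)|].
Qed.

Definition stone_cech_lift (z : stone_cech R X) : stone_cech R T :=
  exist _ (cube_map (set_val z)) (mem_set (@cube_map_closure z)).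

Lemma stone_cech_map : exists2 F : stone_cech R X -> stone_cech R T,
  continuous F & forall x, F (to_stone_cech R x) = to_stone_cech R (f x).
Proof.
exists stone_cech_lift.
  apply/continuousP => _ [V oV <-].
  rewrite (_ : _ @^-1` _ = (cube_map \o set_val) @^-1` V)//.
  have /continuousP : continuous (cube_map \o (set_val : stone_cech R X -> _)).
    by move=> z; apply: continuous_comp;
      [exact: stone_cech_val_continuous|exact: cube_map_continuous].
  by apply.
by move=> x; apply: val_inj.
Qed.

End stone_cech_functor.

Section cech_complete_extensions.
Variables (R : realType) (X : topologicalType).
Hypothesis lcX : locally_compact_space X.
Local Notation bX := (stone_cech R X).
Local Notation b := (@to_stone_cech R X).
Variable T : one_point_extension X.
Local Notation bT := (stone_cech R T).
Local Notation bt := (@to_stone_cech R T).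
Variable F : bX -> bT.
Hypotheses (cF : continuous F) (FE : forall x, F (b x) = bt (ext_map T x)).

Lemma stone_cech_map_surj (y : bT) : exists z, F z = y.
Proof.
have clF : closed (range F).
  apply: compact_closed; first exact: stone_cech_hausdorff.
  apply: continuous_compact; last exact: stone_cech_compact.
  exact: continuous_subspaceT.
suff : closure (range F) y by move=> /clF[z _ <-]; exists z.
move=> N; rewrite nbhsE => -[V [oV Vy] VN].
have [|_ [/[swap] [[t _ <-]] Vt]] := @to_stone_cech_dense R T V _ oV.
  by exists y.
have oV' : open (bt @^-1` V).
  by have /continuousP := @to_stone_cech_continuous R T; apply.
have [|_ [/[swap] [[x _ <-]] Vx]] := @ext_dense _ T _ _ oV'; first by exists t.
exists (F (b x)); split; first by exists (b x).
by apply: VN; rewrite FE.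
Qed.

Lemma stone_cech_map_apex (z : bX) : F z = bt (apex T) <-> ~ away T z.
Proof.
split=> [Fz [W zW nW]|nz].
  apply: nW; set C := closure _.
  have eT := to_stone_cech_embedding R (ext_tychonoff T).
  have clC : closed C by exact: closed_closure.
  rewrite -(embedding_closure_preimage eT clC) /= -Fz => N /cF zN.
  have [_ [[x Wx <-] Nx]] :=
    dense_closure_preimage (@to_stone_cech_dense R X) zW zN.
  exists (F (b x)); split=> //; exists (ext_map T x) => //.
  by apply: subset_closure; exists x.
apply: contrapT => Fz; apply: nz.
have [A [C [oA oC Az Cp AC]]] :=
  hausdorff_separate (@stone_cech_hausdorff R T) Fz.
exists (F @^-1` A).
  by apply: open_nbhs_nbhs; split=> //; move/continuousP : cF; apply.
apply: (@open_notin_closure _ (bt @^-1` C)) => //.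
  by have /continuousP := @to_stone_cech_continuous R T; apply.
apply/seteqP; split=> // _ [/[swap] [[x Ax <-]] Cx].
suff : (A `&` C) (F (b x)) by rewrite AC.
by split=> //; rewrite FE.
Qed.

(** The map F sends remainder to remainder: X is locally compact and open in T, so
    points of X close to x in bT stay in a compact subset of X. *)
Lemma stone_cech_map_point (z : bX) x : F z = bt (ext_map T x) -> range b z.
Proof.
move=> Fz; apply: contrapT => nz.
have [hX lX] := lcX; have [K xK [cK clK]] := lX x I.
have {}xK : nbhs x K by move: xK; rewrite withinET.
have eT := to_stone_cech_embedding R (ext_tychonoff T).
have oK := ext_map_open lcX T (@open_interior _ K).
have [V oV VK] := (embedding_openE eT _).1 oK.
have zK : nbhs z (F @^-1` V `&` ~` (b @` K)).
  apply: filterI; apply: open_nbhs_nbhs; split.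
  - by move/continuousP : cF; apply.
  - rewrite /= Fz; change ((bt @^-1` V) (ext_map T x)); rewrite VK.
    by exists x.
  - apply: closed_openC; apply: compact_closed; first exact: stone_cech_hausdorff.
    apply: continuous_compact => //; apply: continuous_subspaceT.
    exact: to_stone_cech_continuous.
  - by move=> [y _ yz]; apply: nz; exists y.
move: zK; rewrite nbhsE => -[G [oG Gz] GK].
have [|_ [/[swap] [[y _ <-]] Gy]] := @to_stone_cech_dense R X _ _ oG.
  by exists z.
have [Vy nKy] := GK _ Gy; apply: nKy; exists y => //.
have : (bt @^-1` V) (ext_map T y) by rewrite /= -FE.
rewrite VK => -[y' Ky' yy']; have [jinj _] := ext_embedding T.
by apply: interior_subset; rewrite -(jinj _ _ yy').
Qed.

Lemma stone_cech_map_range (z : bX) :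
  range bt (F z) <-> ~ (away T `\` range b) z.
Proof.
split=> [[t _ Ft] [az nz]|naz].
  have [tp|[x tx]] := ext_cases t.
    by have /stone_cech_map_apex : F z = bt (apex T) by rewrite -Ft tp.
  by apply: nz; apply: (@stone_cech_map_point z x); rewrite -Ft tx.
have [[x _ <-]|nz] := pselect (range b z).
  by rewrite FE; exists (ext_map T x).
have [az|/stone_cech_map_apex->] := pselect (away T z); first by case: naz.
by exists (apex T).
Qed.

(** By [stone_cech_map_range], F maps [away T] \ X onto the complement of T in bT,
    and it is the full preimage of that complement.  Both preimages and images
    under F of closed sets are compact. *)
Lemma Gdelta_sigma_compact_away :
  Gdelta (range bt) <-> sigma_compact (away T `\` range b).
Proof.
split=> [[G oG GE]|[K cK KE]].
  exists (fun n => F @^-1` (~` G n)).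
    move=> n; apply: closed_stone_cech_compact.
    by move/continuous_closedP : cF; apply; exact: open_closedC.
  apply/seteqP; split=> z => [az|[n _ nGz]].
    apply: contrapT => nG; have /stone_cech_map_range : range bt (F z).
      rewrite GE => n _; apply: contrapT => nGz; apply: nG.
      by exists n.
    by apply.
  apply: contrapT => /stone_cech_map_range; rewrite GE => /(_ n I).
  exact: nGz.
exists (fun n => ~` (F @` K n)).
  move=> n; apply: closed_openC; apply: compact_closed.
    exact: stone_cech_hausdorff.
  by apply: continuous_compact => //; exact: continuous_subspaceT.
apply/seteqP; split=> y; have [z <-] := stone_cech_map_surj y.
  move=> + n _ [z' Kz' zz']; rewrite -zz' => /stone_cech_map_range; apply.
  by rewrite KE; exists n.
move=> nK; apply/stone_cech_map_range; rewrite KE => -[n _ Kz].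
by apply: (nK n) => //; exists z.
Qed.

End cech_complete_extensions.

Lemma cech_complete_away (R : realType) (X : topologicalType)
    (T : one_point_extension X) :
  locally_compact_space X ->
  cech_complete R T <->
  sigma_compact (@away R X T `\` range (@to_stone_cech R X)).
Proof.
move=> lcX.
have [F cF FE] := @stone_cech_map R X T _ (@ext_map_continuous X T).
rewrite -(Gdelta_sigma_compact_away lcX cF FE); split=> [[]//|GT].
by split=> //; exact: ext_tychonoff.
Qed.

(** * The extension attached to an open set *)

(** The space obtained from X and the closed set bX \ E by collapsing the latter to
    the point [None].  The type depends on E so that each E can carry its own
    topology. *)
Definition attach (R : realType) (X : topologicalType)
  (E : set (stone_cech R X)) : Type := option X.

Section attach_topology.
Variables (R : realType) (X : topologicalType) (E : set (stone_cech R X)).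
Local Notation bX := (stone_cech R X).
Local Notation b := (@to_stone_cech R X).
Local Notation cl A := (closure (b @` A)).

HB.instance Definition _ := Choice.on (attach E).

(** A neighbourhood of [None] is the trace of a neighbourhood of bX \ E: no point of
    bX \ E is adherent to its complement in X. *)
Definition attach_open : set_system (attach E) :=
  [set U | open (Some @^-1` U : set X) /\
    (U None -> cl (~` (Some @^-1` U)) `<=` E)].

Let attach_openT : attach_open setT.
Proof.
split=> [|_]; first exact: openT.
by rewrite preimage_setT setCT image_set0 closure0.
Qed.

Let attach_openI : setI_closed attach_open.
Proof.
move=> U V [oU UE] [oV VE]; split=> [|[UN VN]].
  by rewrite preimage_setI; exact: openI.
rewrite preimage_setI setCI image_setU closureU.
by rewrite subUset; split; [exact: UE|exact: VE].
Qed.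

Let attach_open_bigcup (I : Type) (f : I -> set (attach E)) :
  (forall i, attach_open (f i)) -> attach_open (\bigcup_i f i).
Proof.
move=> fo; split=> [|[i _ fiN]].
  rewrite preimage_bigcup; apply: bigcup_open => i _; exact: (fo i).1.
apply: subset_trans ((fo i).2 fiN); apply/closure_subset/image_subset.
by apply: subsetC => x fx; exists i.
Qed.

HB.instance Definition _ := isOpenTopological.Build (attach E)
  attach_openT attach_openI attach_open_bigcup.

Lemma attach_openE (U : set (attach E)) : open U <-> attach_open U.
Proof. by []. Qed.

Definition attach_map (x : X) : attach E := Some x.

Lemma attach_embedding : topological_embedding attach_map.
Proof.
split=> [x y [->]//|]; apply/seteqP; split=> [U oU|U [V [oV _] <-]]; last exact: oV.
exists (attach_map @` U).
  split=> [|[]//]; rewrite (_ : _ @^-1` _ = U)//.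
  by apply/seteqP; split=> x => [[y Uy [<-]]|Ux]//; exists x.
by apply/seteqP; split=> x => [[y Uy [<-]]|Ux]//; exists x.
Qed.

Hypotheses (lcX : locally_compact_space X) (oE : open E).
Hypotheses (bE : range b `<=` E) (nE : E <> setT).

Lemma attach_dense : dense (range attach_map).
Proof.
move=> U [[x|] Ut] [oU UE]; first by exists (Some x); split=> //; exists x.
apply: contrapT => /nonemptyPn U0; apply: nE; apply/seteqP; split=> // z _.
apply: (UE Ut); rewrite (_ : ~` _ = setT).
  have := @dense_closure_preimage _ _ b (@to_stone_cech_dense R X) z setT.
  by rewrite preimage_setT; apply; exact: filterT.
apply/seteqP; split=> // x _ Ux.
suff : (U `&` range attach_map) (Some x) by rewrite U0.
by split=> //; exists x.
Qed.

Lemma attach_singleton : exists p, ~` range attach_map = [set p].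
Proof.
exists None; apply/seteqP; split=> [[x|//] nx|_ -> [x _ //]].
by case: nx; exists x.
Qed.

(** The function induced on the collapsed space by a function h on bX that has the
    constant value c outside E. *)
Definition glue (h : bX -> R) (c : R) (t : attach E) : R :=
  if t is Some x then h (b x) else c.

Lemma glue_continuous (h : bX -> R) (c : R) :
  continuous h -> (forall z, ~ E z -> h z = c) -> continuous (glue h c).
Proof.
move=> ch hc; apply/continuousP => V oV.
have oh : open (h @^-1` V) by move/continuousP : ch; apply.
split=> [|/= Vc z clz].
  have /continuousP := @to_stone_cech_continuous R X.
  by move=> /(_ _ oh).
apply: contrapT => nEz.
apply: (open_cl_disjoint oh _ _ clz); first by move=> x.
by rewrite /= hc.
Qed.

Lemma stone_cech_separate (K L : set bX) : closed K -> closed L ->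
  K `&` L = set0 -> exists h : bX -> R, [/\ continuous h,
    (forall z, 0 <= h z <= 1), (forall z, K z -> h z = 0) &
    (forall z, L z -> h z = 1)].
Proof.
move=> clK clL KL.
have nX := compact_normal (@stone_cech_hausdorff R X) (@stone_cech_compact R X).
have /(@uniform_separatorP _ R)[h [ch h01 h0 h1]] :=
  normal_uniform_separator nX clK clL KL.
exists h; split=> // z; first by have /= := h01 _ (imageT h z); rewrite in_itv.
- by move=> Kz; apply: h0; exists z.
- by move=> Lz; apply: h1; exists z.
Qed.

(** Disjoint closed sets of the compact space bX are separated by a function h;
    if one of them contains bX \ E, then h induces a function on the collapsed
    space. *)
Lemma attach_completely_regular : completely_regular_space (attach E).
Proof.
move=> a B clB nBa; apply/(@uniform_separatorP _ R).
pose A : set X := Some @^-1` B.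
have [oCA CAE] := (attach_openE _).1 (closed_openC clB).
have clA : closed A by rewrite -openC.
have {}CAE : ~ B None -> cl A `<=` E.
  move=> nBN; have := CAE nBN; rewrite (_ : ~` (Some @^-1` ~` B) = A)//.
  by rewrite preimage_setC setCK.
have finish (h : bX -> R) c : continuous h -> (forall z, 0 <= h z <= 1) ->
    (forall z, ~ E z -> h z = c) -> 0 <= c <= 1 -> glue h c a = 0 ->
    (forall x, A x -> h (b x) = 1) -> (B None -> c = 1) ->
    exists f : attach E -> R, [/\ continuous f, range f `<=` `[0, 1],
     f @` [set a] `<=` [set 0] & f @` B `<=` [set 1]].
  move=> ch h01 hc c01 ha hA hB; exists (glue h c); split.
  - exact: glue_continuous.
  - by move=> _ [[x|] _ <-] /=; rewrite in_itv //=; exact: h01.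
  - by move=> _ [_ -> <-].
  - by move=> _ [[x|] Bx <-] /=; [exact: hA|exact: hB].
have clA1 x : A x -> cl A (b x) by move=> Ax; apply: subset_closure; exists x.
have nEcl : closed (~` E) by exact: open_closedC.
(* At a point of X, the set bX \ E is sent to 1 even if B does not contain
   [None], so that h is constant on it. *)
case: a nBa finish => [x|] nBa finish.
  have [|||h [ch h01 h0 h1]] := @stone_cech_separate [set b x] (cl A `|` ~` E).
  - exact: accessible_closed_set1 (hausdorff_accessible (@stone_cech_hausdorff R X)) _.
  - apply: closedU => //; exact: closed_closure.
  - apply/seteqP; split=> // _ [-> [Ax|]]; last by apply; apply: bE; exists x.
    apply: nBa; have : (b @^-1` cl A) x by [].
    by rewrite (embedding_closure_preimage (stone_cech_embedding R lcX) clA).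
  apply: (finish h 1) => //.
  - by move=> z nEz; apply: h1; right.
  - by rewrite ler01 lexx.
  - exact: h0.
  - by move=> y Ay; apply: h1; left; exact: clA1.
have [|||h [ch h01 h0 h1]] := @stone_cech_separate (~` E) (cl A).
- exact: nEcl.
- exact: closed_closure.
- by apply/seteqP; split=> // z [nEz /(CAE nBa)].
apply: (finish h 0) => //.
- by rewrite ler01 lexx.
- by move=> y Ay; apply: h1; exact: clA1.
Qed.

Lemma attach_closed1 (t : attach E) : closed [set t].
Proof.
rewrite -openC; case: t => [x|]; apply/attach_openE; split.
- rewrite (_ : _ @^-1` _ = ~` [set x]).
    apply: closed_openC; have [hX _] := lcX.
    exact: accessible_closed_set1 (hausdorff_accessible hX) _.
  by apply/seteqP; split=> y /= nyx; [move=> yx; apply: nyx; rewrite yx|case].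
- move=> _; rewrite (_ : ~` (_ @^-1` _) = [set x]).
    rewrite image_set1 -(closure_id _).1; last first.
      exact: accessible_closed_set1 (hausdorff_accessible (@stone_cech_hausdorff R X)) _.
    by move=> _ ->; apply: bE; exists x.
  by apply/seteqP; split=> y /=; [move=> /contrapT[]|move=> -> /(_ erefl)].
- by rewrite (_ : _ @^-1` _ = setT); [exact: openT|apply/seteqP; split].
- by move=> /(_ erefl).
Qed.

Lemma attach_tychonoff : tychonoff_space (attach E).
Proof.
split; last exact: attach_completely_regular.
move=> s t st; apply: contrapT => nst.
have /(@uniform_separatorP _ R)[f [cf _ fs ft]] :=
  attach_completely_regular (@attach_closed1 t) nst.
have fs0 : f s = 0 by apply: fs; exists s.
have ft1 : f t = 1 by apply: ft; exists t.
have [||u [/= fu fu']] := st (f @^-1` [set r | r < 2^-1]) (f @^-1` [set r | 2^-1 < r]).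
- apply: open_nbhs_nbhs; split; last by rewrite /= fs0 invr_gt0.
  by move/continuousP : cf; apply; exact: open_lt.
- apply: open_nbhs_nbhs; split; last by rewrite /= ft1 invf_lt1 ?ltr1n.
  by move/continuousP : cf; apply; exact: open_gt.
by have := lt_trans fu fu'; rewrite ltxx.
Qed.

Definition attach_extension : one_point_extension X :=
  OnePointExtension attach_tychonoff attach_embedding attach_dense
    attach_singleton.

Lemma apex_attach : apex attach_extension = None.
Proof.
have := apexE attach_extension => /seteqP[/(_ None) h _].
by apply/esym/h => -[x].
Qed.

Lemma attach_notin_closureP (A : set X) :
  ~ closure (attach_map @` A) None <-> cl A `<=` E.
Proof.
split=> [/notin_closure[U [[oU UE] UN UA]]|AE].
  apply: subset_trans (UE UN); apply/closure_subset/image_subset => x Ax Ux.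
  suff : (U `&` attach_map @` A) (Some x) by rewrite UA.
  by split=> //; exists x.
pose U : set (attach E) := None |` attach_map @` (~` (b @^-1` cl A)).
have UE : Some @^-1` U = ~` (b @^-1` cl A).
  by apply/seteqP; split=> x => [[//|[y ny [<-]]]|nx]//; right; exists x.
apply: (@open_notin_closure _ U); last first.
- apply/seteqP; split=> // t [Ut [x Ax xt]]; move: Ut; rewrite -xt.
  change ((Some @^-1` U) x -> False); rewrite UE; apply.
  by apply: subset_closure; exists x.
- by left.
- apply/attach_openE; split=> [|_]; rewrite UE.
    apply: closed_openC; have /continuous_closedP := @to_stone_cech_continuous R X.
    by apply; exact: closed_closure.
  rewrite setCK; apply: subset_trans AE.
  rewrite [X in _ `<=` X](closure_id _).1; last exact: closed_closure.
  by apply: closure_subset => _ [x clx <-].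
Qed.

Lemma away_attach : away attach_extension = E.
Proof.
(* An open set of bX is determined by the closures cl A that it contains. *)
have sub (U V : set bX) : open U -> (forall A : set X, cl A `<=` U -> cl A `<=` V) ->
    U `<=` V.
  move=> oU UV z Uz.
  have zU : nbhs z U by exact: open_nbhs_nbhs.
  have [W zW WU] := compact_regular (@stone_cech_hausdorff R X)
    (@stone_cech_compact R X) (@filterT _ (nbhs z) _) zU.
  apply: (UV (b @^-1` W)).
    by apply: subset_trans WU; apply: closure_subset => _ [x Wx <-].
  exact: (dense_closure_preimage (@to_stone_cech_dense R X) zW).
have aE A : cl A `<=` away attach_extension <-> cl A `<=` E.
  have := @notin_closure_awayP R X attach_extension A.
  rewrite apex_attach => <-; exact: attach_notin_closureP.
apply/seteqP; split; apply: sub => //; first exact: open_away.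
- by move=> A /aE.
- by move=> A /aE.
Qed.

End attach_topology.

(** * The poset of Cech-complete Lindelof extensions *)

Section correspondence.
Variables (R : realType) (X : topologicalType).
Hypotheses (lcX : locally_compact_space X) (pX : paracompact_space X).
Local Notation bX := (stone_cech R X).
Local Notation b := (@to_stone_cech R X).
Local Notation sX := (@sigma_extension R X).
Local Notation S := (sigma_remainder R X).
Implicit Type T : one_point_extension X.

Let v : S -> bX := set_val.

Let v_embedding : topological_embedding v := set_val_embedding _.

Let v_continuous : continuous v := embedding_continuous v_embedding.

Lemma sigma_remainder_val (z : bX) : sX z -> ~ range b z -> exists y : S, v y = z.
Proof.
move=> sz nz; have Sz : (sX `\` range b) z by [].
by exists (exist _ z (mem_set Sz)).
Qed.

Lemma sigma_remainderP (y : S) : sX (v y) /\ ~ range b (v y).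
Proof. by have [] := set_valP y. Qed.

Lemma ext_equiv_le T1 T2 : ext_equiv T1 T2 -> ext_le T1 T2 /\ ext_le T2 T1.
Proof.
move=> [f [g [cf cg fK gK fj]]]; split; last by exists f.
by exists g => // x; rewrite -fj fK.
Qed.

Lemma ext_equivP T1 T2 : ext_equiv T1 T2 <-> @away R X T1 = away T2.
Proof.
split=> [/ext_equiv_le[/(ext_leP R lcX) h1 /(ext_leP R lcX) h2]|aa].
  exact/seteqP.
have [f cf fj] : ext_le T2 T1 by apply/(ext_leP R lcX); rewrite aa.
have [g cg gj] : ext_le T1 T2 by apply/(ext_leP R lcX); rewrite aa.
have fp := ext_le_apex lcX cf fj; have gp := ext_le_apex lcX cg gj.
exists f, g; split=> // t; have [->|[x ->]] := ext_cases t.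
- by rewrite fp gp.
- by rewrite fj gj.
- by rewrite gp fp.
- by rewrite gj fj.
Qed.

Definition class_of T : ext_class X := exist _ (ext_equiv T) (ex_intro _ T erefl).

Lemma class_of_self T : sval (class_of T) T.
Proof. exact/ext_equivP. Qed.

Definition away_class (C : ext_class X) : set bX :=
  [set z | exists2 T, sval C T & away T z].

Lemma away_classE (C : ext_class X) T : sval C T -> away_class C = away T.
Proof.
have [T0 CT0] := svalP C; move=> CT.
have away_T0 T' : sval C T' -> away T' = @away R X T0.
  by rewrite CT0 => /ext_equivP.
apply/seteqP; split=> z => [[T' CT' az]|az]; last by exists T.
by rewrite (away_T0 _ CT) -(away_T0 _ CT').
Qed.

Lemma ext_class_ext (C1 C2 : ext_class X) :
  away_class C1 = away_class C2 -> C1 = C2.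
Proof.
move=> aC; apply: sval_inj; move: aC.
have [T1 CT1] := svalP C1; have [T2 CT2] := svalP C2.
have h1 : sval C1 T1 by rewrite CT1; exact/ext_equivP.
have h2 : sval C2 T2 by rewrite CT2; exact/ext_equivP.
rewrite (away_classE h1) (away_classE h2) CT1 CT2 => aT.
apply: funext => T; apply: propext.
by rewrite !ext_equivP aT.
Qed.

Lemma ext_class_leP (C2 C1 : ext_class X) :
  ext_class_le C2 C1 <-> away_class C2 `<=` away_class C1.
Proof.
split=> [[T1 [T2 [h1 h2]]] /(ext_leP R lcX)|aC].
  by rewrite (away_classE h1) (away_classE h2).
have [T1 CT1] := svalP C1; have [T2 CT2] := svalP C2.
have h1 : sval C1 T1 by rewrite CT1; exact/ext_equivP.
have h2 : sval C2 T2 by rewrite CT2; exact/ext_equivP.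
exists T1, T2; split=> //; apply/(ext_leP R lcX).
by rewrite -(away_classE h1) -(away_classE h2).
Qed.

(** The sets [away T] for T Cech-complete and Lindelof. *)
Definition CL_set (E : set bX) :=
  [/\ open E, range b `<=` E, E <> setT, E `<=` sX &
      sigma_compact (E `\` range b)].

Lemma away_class_CL_set (C : ext_class_CL R X) : CL_set (away_class (sval C)).
Proof.
have [T [CT ccT lT]] := svalP C; rewrite (away_classE CT); split.
- exact: open_away.
- exact: range_away.
- exact: away_neqT.
- exact: lindelof_away.
- exact/cech_complete_away.
Qed.

Lemma CL_set_class (E : set bX) :
  CL_set E -> exists C : ext_class_CL R X, away_class (sval C) = E.
Proof.
move=> [oE bE nE Es sE]; pose T := attach_extension lcX oE bE nE.
have aT : away T = E by exact: away_attach.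
have CT : exists T', [/\ sval (class_of T) T', cech_complete R T' & lindelof_space T'].
  exists T; split; first exact: class_of_self.
    by apply/cech_complete_away => //; rewrite aT.
  by apply: (@away_lindelof R X lcX pX); rewrite aT.
by exists (exist _ (class_of T) CT) => /=; rewrite (away_classE (class_of_self T)).
Qed.

(** The inverse of the trace on the remainder, on the sets between X and sX. *)
Definition fill (D : set S) : set bX := range b `|` v @` D.

Lemma preimage_fill (D : set S) : v @^-1` fill D = D.
Proof.
apply/seteqP; split=> y => [[by_|[y' Dy' yy']]|Dy].
- by have [_] := sigma_remainderP y.
- by rewrite -(val_inj yy').
- by right; exists y.
Qed.

Lemma fill_preimage (E : set bX) : CL_set E -> fill (v @^-1` E) = E.
Proof.
move=> [_ bE _ Es _]; apply/seteqP; split=> z => [[/bE//|[y Ey <-]//]|Ez].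
have [bz|nz] := pselect (range b z); first by left.
have [y yz] := sigma_remainder_val (Es _ Ez) nz.
by right; exists y => //; rewrite /= yz.
Qed.

Lemma fill_diff (D : set S) : fill D `\` range b = v @` D.
Proof.
apply/seteqP; split=> z => [[[//|//]]|[y Dy <-]].
have [_ ny] := sigma_remainderP y; split=> //; right; by exists y.
Qed.

Lemma preimage_proper (E : set bX) : CL_set E ->
  [/\ open (v @^-1` E), sigma_compact (v @^-1` E) & v @^-1` E <> setT].
Proof.
move=> CE; have [oE bE nE Es sE] := CE.
have sD : sigma_compact (v @^-1` E).
  move: sE; rewrite -{1}(fill_preimage CE) fill_diff => -[K cK vE].
  exists (fun n => v @^-1` K n) => [n|].
    apply: (embedding_compact v_embedding); rewrite (_ : _ @` _ = K n) //.
    apply/seteqP; split=> z => [[y Ky <-]//|Kz].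
    have : (v @` (v @^-1` E)) z by rewrite vE; exists n.
    by move=> [y _ yz]; exists y => //; rewrite /= yz.
  apply/seteqP; split=> y => [Ey|[n _ Ky]].
    have : (v @` (v @^-1` E)) (v y) by exists y.
    by rewrite vE => -[n _ Ky]; exists n.
  have : (v @` (v @^-1` E)) (v y) by rewrite vE; exists n.
  by move=> [y' Ey' yy']; rewrite -(val_inj yy').
split=> //; first by have /continuousP := v_continuous; apply.
move=> DT; apply: nE; apply/seteqP; split=> // z _.
have sT : sX = setT by apply: sigma_compact_remainder; rewrite -?DT.
have [/bE//|nz] := pselect (range b z).
have [|y <-] := @sigma_remainder_val z _ nz; first by rewrite sT.
by have : (v @^-1` E) y by rewrite DT.
Qed.

Lemma CL_set_fill (D : set S) : open D -> sigma_compact D -> D <> setT ->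
  CL_set (fill D).
Proof.
move=> oD sD nD; split.
- have [V oV VD] := (embedding_openE v_embedding _).1 oD.
  rewrite (_ : fill D = range b `|` (V `&` sX)).
    apply: openU; first exact: open_range_stone_cech.
    by apply: openI => //; exact: open_sigma_extension.
  apply/seteqP; split=> z.
    move=> [bz|[y Dy <-]]; [by left|right].
    have [sy _] := sigma_remainderP y; split=> //.
    by move: Dy; rewrite -VD.
  move=> [bz|[Vz sz]]; first by left.
  have [bz|nz] := pselect (range b z); first by left.
  have [y yz] := sigma_remainder_val sz nz; right; exists y => //.
  by rewrite -VD /= yz.
- by move=> z bz; left.
- by move=> DT; apply: nD; rewrite -(preimage_fill D) DT preimage_setT.
- move=> _ [[x _ <-]|[y _ <-]].
    by apply: range_sigma_extension; exists x.
  by have [] := sigma_remainderP y.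
- by rewrite fill_diff; exact: sigma_compact_image.
Qed.

Lemma ext_class_CL_isomorphic :
  order_isomorphic (@ext_class_CL_le R X) (@subset_le S).
Proof.
pose f (C : ext_class_CL R X) : open_sigma_compact_proper S :=
  exist _ _ (preimage_proper (away_class_CL_set C)).
have /choice[g gE] : forall D : open_sigma_compact_proper S,
    exists C : ext_class_CL R X, away_class (sval C) = fill (sval D).
  by move=> D; apply: CL_set_class; have [] := svalP D; exact: CL_set_fill.
have fK : cancel f g.
  move=> C; apply: sval_inj; apply: ext_class_ext.
  by rewrite gE /= fill_preimage //; exact: away_class_CL_set.
have gK : cancel g f by move=> D; apply: sval_inj; rewrite /= gE preimage_fill.
exists f, g; split=> // [C1 C2 /ext_class_leP C12 y|D1 D2 D12].
  exact: C12.
apply/ext_class_leP; rewrite !gE => z [bz|[y Dy <-]]; first by left.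
by right; exists y => //; exact: D12.
Qed.

End correspondence.

Theorem theorem3p21 (R : realType) (X Y : topologicalType)
  (lcX : locally_compact_space X) (pX : paracompact_space X)
  (lcY : locally_compact_space Y) (pY : paracompact_space Y) :
  order_isomorphic (@ext_class_CL_le R X) (@ext_class_CL_le R Y) <->
  homeomorphic (sigma_remainder R X) (sigma_remainder R Y).
Proof.
have isoX := ext_class_CL_isomorphic R lcX pX.
have isoY := ext_class_CL_isomorphic R lcY pY.
split=> [isoXY|homeo].
  apply: (@homeomorphic_of_order_isomorphic R).
  - exact: sigma_remainder_hausdorff.
  - exact: sigma_remainder_bounded.
  - exact: sigma_remainder_hausdorff.
  - exact: sigma_remainder_bounded.
  - apply: order_isomorphic_trans isoY.
    exact: order_isomorphic_trans (order_isomorphic_sym isoX) isoXY.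
apply: order_isomorphic_trans isoX _.
apply: order_isomorphic_trans (order_isomorphic_sym isoY).
exact: order_isomorphic_of_homeomorphic.
Qed.
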